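(* Let $0<\sigma<\infty$. Every weak$^*$ exposed point of $D(B^1_\sigma)$ is weak$^*$ strongly exposed; that is, the set of weak$^*$ exposed points of $D(B^1_\sigma)$ equals the set of weak$^*$ strongly exposed points of $D(B^1_\sigma)$.
   Context: For $0<\sigma<\infty$, $B^1_\sigma$ is the space of $f\in L^1(\mathbb{R})$ whose Fourier transform is supported in $[-\sigma,\sigma]$, with the $L^1(\mathbb{R})$ norm; $D(B^1_\sigma)$ is its closed unit ball. $C_0(\mathbb{R})$ is the space of continuous complex functions vanishing at infinity; with $\mathfrak{I}_\sigma$ the finite complex Borel measures on $\mathbb{R}$ whose Fourier–Stieltjes transform vanishes for $|t|\ge\sigma$ and $C_{0,\sigma}(\mathbb{R})=\{u\in C_0(\mathbb{R}):\int u\,d\mu=0\ \forall\mu\in\mathfrak{I}_\sigma\}$, $B^1_\sigma$ is the dual of $C_0(\mathbb{R})/C_{0,\sigma}(\mathbb{R})$ via $\langle f,[u]\rangle=\int f u\,dx$; weak$^*$ refers to this duality. A point $f\in D(B^1_\sigma)$ is exposed if there is a continuous linear functional $\Phi_f$ on $B^1_\sigma$ with $\Phi_f(f)=\|\Phi_f\|=1$ and $\mathrm{Re}\,\Phi_f(g)<1$ for all $g\in D(B^1_\sigma)$, $g\ne f$ (this functional is unique). An exposed $f$ is strongly exposed if every sequence $(f_n)$ in $D(B^1_\sigma)$ with $\Phi_f(f_n)\to1$ converges to $f$ in norm; it is weak$^*$ exposed if $\Phi_f$ is weak$^*$ continuous; it is weak$^*$ strongly exposed if it is both weak$^*$ exposed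 and strongly exposed. *)

(* Defs.v *)
From HB Require Import structures.
From mathcomp Require Import all_boot all_order all_algebra.
From mathcomp Require Import all_classical all_reals all_analysis.
From mathcomp Require Import complex.

Set Implicit Arguments.
Unset Strict Implicit.
Unset Printing Implicit Defensive.

Import Order.TTheory GRing.Theory Num.Theory.
Import numFieldNormedType.Exports.
Local Open Scope classical_set_scope.
Local Open Scope ring_scope.

Section BernsteinSpace.
Variable R : realType.

Local Notation F := (R -> R[i]).
Local Notation leb := (@lebesgue_measure R).

Definition cRe (z : R[i]) : R := complex.Re z.
Definition cIm (z : R[i]) : R := complex.Im z.

Definition cnorm (z : R[i]) : R := Num.sqrt (cRe z ^+ 2 + cIm z ^+ 2).

Definition cintegrable (f : F) : Prop :=
  leb.-integrable setT (fun x => (cRe (f x))%:E) /\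
  leb.-integrable setT (fun x => (cIm (f x))%:E).

Definition cint (f : F) : R[i] :=
  Complex (Rintegral leb setT (fun x => cRe (f x)))
          (Rintegral leb setT (fun x => cIm (f x))).

Definition L1norm (f : F) : R := Rintegral leb setT (fun x => cnorm (f x)).

Definition L1eq (f g : F) : Prop := {ae leb, forall x, f x = g x}.

Definition expi (t : R) : R[i] := Complex (cos t) (sin t).

Definition fourier (f : F) (t : R) : R[i] :=
  cint (fun x => f x * expi (- (x * t))).

Definition inB (sigma : R) (f : F) : Prop :=
  cintegrable f /\ forall t, sigma < `|t| -> fourier f t = 0.

Definition inD (sigma : R) (f : F) : Prop := inB sigma f /\ L1norm f <= 1.

Definition linear_on_B (sigma : R) (Phi : F -> R[i]) : Prop :=
  forall (a : R[i]) (f g : F), inB sigma f -> inB sigma g ->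
    Phi (fun x => a * f x + g x) = a * Phi f + Phi g.

Definition norm_continuous_on_B (sigma : R) (Phi : F -> R[i]) : Prop :=
  forall g, inB sigma g -> forall e : R, 0 < e ->
    exists d : R, 0 < d /\
      forall h, inB sigma h -> L1norm (fun x => h x - g x) < d ->
        cnorm (Phi h - Phi g) < e.

Definition cont_lin_functional (sigma : R) (Phi : F -> R[i]) : Prop :=
  linear_on_B sigma Phi /\ norm_continuous_on_B sigma Phi.

Definition opnorm (sigma : R) (Phi : F -> R[i]) : R :=
  sup [set r | exists2 g, inD sigma g & r = cnorm (Phi g)].

Definition exposing (sigma : R) (f : F) (Phi : F -> R[i]) : Prop :=
  cont_lin_functional sigma Phi /\ Phi f = 1 /\ opnorm sigma Phi = 1 /\
  forall g, inD sigma g -> ~ L1eq g f -> cRe (Phi g) < 1.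

Definition exposed (sigma : R) (f : F) : Prop :=
  inD sigma f /\ exists Phi, exposing sigma f Phi.

Definition strongly_exposed (sigma : R) (f : F) : Prop :=
  exposed sigma f /\
  forall Phi, exposing sigma f Phi ->
    forall fn : nat -> F, (forall n, inD sigma (fn n)) ->
      (fun n => cnorm (Phi (fn n) - 1) : R) @ \oo --> 0 ->
      (fun n => L1norm (fun x => fn n x - f x) : R) @ \oo --> 0.

Definition C0 (u : F) : Prop :=
  continuous (fun x => cRe (u x)) /\ continuous (fun x => cIm (u x)) /\
  forall e : R, 0 < e -> exists M : R, forall x, M < `|x| -> cnorm (u x) < e.

Definition pairing (f u : F) : R[i] := cint (fun x => f x * u x).

(* Phi is continuous on B^1_sigma for the weak* topology
   sigma(B^1_sigma, C_0(R)/C_{0,sigma}(R)), written with its basic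
   neighbourhoods {h : |<h - g, [u_i]>| < d, i < n}. *)
Definition weakstar_continuous (sigma : R) (Phi : F -> R[i]) : Prop :=
  forall g, inB sigma g -> forall e : R, 0 < e ->
    exists (n : nat) (us : 'I_n -> F) (d : R),
      0 < d /\ (forall i, C0 (us i)) /\
      forall h, inB sigma h ->
        (forall i, cnorm (pairing (fun x => h x - g x) (us i)) < d) ->
        cnorm (Phi h - Phi g) < e.

Definition wstar_exposed (sigma : R) (f : F) : Prop :=
  inD sigma f /\
  exists Phi, exposing sigma f Phi /\ weakstar_continuous sigma Phi.

Definition wstar_strongly_exposed (sigma : R) (f : F) : Prop :=
  wstar_exposed sigma f /\ strongly_exposed sigma f.

End BernsteinSpace.

(* Main.v *)
(** Write a function of the Bernstein space as f = p + i q; since the band is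
symmetric, p and q are band-limited themselves. For a real band-limited h,
Abel summation of the Fourier integral turns the damping e^{-e t} into the
Poisson kernel, whose primitive is an arctangent; letting e tend to 0 gives
h(y) = 1/pi \int_0^sigma \int h(x) cos((y - x) t) dx dt for almost every y.
The right-hand side is smooth and its n-th derivative is O(sigma^n). Hence
D(B^1_sigma) is uniformly bounded and equi-Lipschitz, and Taylor's formula
shows that a nonzero function of B^1_sigma vanishes only on a null set.

Let f be exposed by the weak* continuous functional Phi. As f <> 0 a.e., the
norm is Gateaux differentiable at f, so Phi is the only functional exposing
f. If f_n in D and Phi(f_n) -> 1, a subsequence converges pointwise to some g
in D; weak* continuity gives Phi(g) = 1, so g = f, and ||f_n|| <= 1 = ||f||
upgrades pointwise convergence to norm convergence (Scheffe). *)

Require Import Defs.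
From mathcomp Require Import all_boot all_order all_algebra.
From mathcomp Require Import all_classical all_reals all_analysis.
From mathcomp Require Import complex.
From mathcomp Require Import measurable_realfun ring lra.
Import Order.TTheory GRing.Theory Num.Theory.
Import numFieldNormedType.Exports.
Set Implicit Arguments.
Unset Strict Implicit.
Unset Printing Implicit Defensive.
Local Open Scope classical_set_scope.
Local Open Scope ring_scope.

Section RealIntegrals.
Context {d} {T : measurableType d} {R : realType}.
Variable mu : {measure set T -> \bar R}.
Implicit Types (h m f g : T -> R) (A : set T) (C : R).

Definition Rintegrable h : Prop := mu.-integrable setT (EFin \o h).

Lemma Rintegrable_measurable h : Rintegrable h -> measurable_fun setT h.
Proof. by move=> /(@measurable_int _ _ _ mu) /measurable_EFinP. Qed.

Lemma Rintegrable0 : Rintegrable (fun=> 0).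
Proof. by apply: eq_integrable (integrable0 mu setT). Qed.

Lemma RintegrableD h g : Rintegrable h -> Rintegrable g ->
  Rintegrable (fun x => h x + g x).
Proof. by move=> ih ig; exact: (integrableD measurableT ih ig). Qed.

Lemma RintegrableB h g : Rintegrable h -> Rintegrable g ->
  Rintegrable (fun x => h x - g x).
Proof. by move=> ih ig; exact: (integrableB measurableT ih ig). Qed.

Lemma RintegrableZl (k : R) h : Rintegrable h -> Rintegrable (fun x => k * h x).
Proof. by move=> ih; exact: (integrableZl measurableT k ih). Qed.

Lemma Rintegrable_norm h : Rintegrable h -> Rintegrable (fun x => `|h x|).
Proof. exact: integrable_norm. Qed.

Lemma le_Rintegrable h g : measurable_fun setT h ->
  (forall x, `|h x| <= g x) -> Rintegrable g -> Rintegrable h.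
Proof.
move=> mh hg ig; apply: le_integrable ig => //; first exact/measurable_EFinP.
by move=> x _ /=; rewrite lee_fin; apply: le_trans (hg x) _; exact: ler_norm.
Qed.

Lemma Rintegrable_mul_bounded h m C : Rintegrable h ->
  measurable_fun setT m -> (forall x, `|m x| <= C) ->
  Rintegrable (fun x => h x * m x).
Proof.
move=> ih mm mC; apply: (@le_Rintegrable _ (fun x => C * `|h x|)).
- by apply: measurable_funM => //; exact: Rintegrable_measurable.
- by move=> x; rewrite normrM mulrC ler_wpM2r.
- exact/RintegrableZl/Rintegrable_norm.
Qed.

Lemma ler_norm_Rintegral_mul_bounded h m C : Rintegrable h ->
  measurable_fun setT m -> (forall x, `|m x| <= C) ->
  `|\int[mu]_x (h x * m x)| <= C * \int[mu]_x `|h x|.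
Proof.
move=> ih mm mC; have ihm := Rintegrable_mul_bounded ih mm mC.
apply: le_trans (le_normr_Rintegral measurableT ihm) _.
rewrite -RintegralZl//; last exact: Rintegrable_norm.
apply: le_Rintegral => //; first exact: Rintegrable_norm.
  exact/RintegrableZl/Rintegrable_norm.
by move=> x _; rewrite normrM mulrC ler_wpM2r.
Qed.

Lemma bounded_integrable A f C : measurable A -> (mu A < +oo)%E ->
  measurable_fun A f -> (forall x, A x -> `|f x| <= C) ->
  mu.-integrable A (EFin \o f).
Proof.
move=> mA Afin mf fC; apply: measurable_bounded_integrable => //.
exists C; split; first exact: num_real.
by move=> M /ltW CM x Ax; exact: le_trans (fC x Ax) CM.
Qed.

Lemma ler_norm_Rintegral_bounded A f C : measurable A -> (mu A < +oo)%E ->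
  measurable_fun A f -> (forall x, A x -> `|f x| <= C) ->
  `|\int[mu]_(x in A) f x| <= C * fine (mu A).
Proof.
move=> mA Afin mf fC; have fi := bounded_integrable mA Afin mf fC.
apply: le_trans (le_normr_Rintegral mA fi) _; rewrite -Rintegral_cst//.
apply: le_Rintegral => //; first exact: integrable_norm.
by apply: (@bounded_integrable _ _ `|C|) => //; exact: measurable_cst.
Qed.

Lemma Rintegral_eq0 A f : (forall x, A x -> f x = 0) ->
  \int[mu]_(x in A) f x = 0.
Proof.
move=> f0; rewrite (@eq_Rintegral _ _ _ _ _ (fun=> 0)) /Rintegral ?integral0//.
by move=> x; rewrite inE; exact: f0.
Qed.

Lemma ae_eq_Rintegral h g : Rintegrable h -> Rintegrable g ->
  {ae mu, forall x, h x = g x} -> \int[mu]_x h x = \int[mu]_x g x.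
Proof.
move=> ih ig hg; congr fine; apply: ae_eq_integral => //.
- exact: (measurable_int mu ih).
- exact: (measurable_int mu ig).
- by apply: filterS hg => x -> _.
Qed.

Lemma ae_eq_Rintegrable h g : Rintegrable h -> measurable_fun setT g ->
  {ae mu, forall x, h x = g x} -> Rintegrable g.
Proof.
move=> /integrableP[mh hoo] mg hg; apply/integrableP.
split; first exact/measurable_EFinP.
rewrite -(@ae_eq_integral _ _ _ mu _ _ (abse \o (EFin \o h)))//.
- exact: measurableT_comp.
- by apply: measurableT_comp => //; exact/measurable_EFinP.
- by apply: filterS hg => x /= -> _.
Qed.

Lemma Rintegral_dominated_cvg (f_ : nat -> T -> R) f g :
  (forall n, measurable_fun setT (f_ n)) -> measurable_fun setT f ->
  {ae mu, forall x, f_ ^~ x @ \oo --> f x} -> Rintegrable g ->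
  (forall n x, `|f_ n x| <= g x) ->
  \int[mu]_x f_ n x @[n --> \oo] --> \int[mu]_x f x.
Proof.
move=> mf_ mf f_f ig f_g.
have [||||fi _] := @dominated_convergence _ _ R mu setT measurableT
  (fun n => EFin \o f_ n) (EFin \o f) (EFin \o g) _ _ _ ig.
- by move=> n; apply/measurable_EFinP; exact: mf_.
- exact/measurable_EFinP.
- by apply: filterS f_f => x fx _; exact: cvg_comp fx _.
- by apply: aeW => x n _ /=; rewrite lee_fin.
by move=> cv; apply: fine_cvg; rewrite fineK//; exact: integrable_fin_num fi.
Qed.

Lemma cvg_Rintegral_mul_bounded (u_ : nat -> T -> R) w C :
  (forall n, measurable_fun setT (u_ n)) -> (forall n x, `|u_ n x| <= C) ->
  (forall x, u_ ^~ x @ \oo --> (0 : R)) -> Rintegrable w ->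
  \int[mu]_x (w x * u_ n x) @[n --> \oo] --> (0 : R).
Proof.
move=> mu_ u_C u_0 iw; have mw := Rintegrable_measurable iw.
rewrite -[X in _ --> X](@Rintegral_eq0 setT (fun=> 0))//.
apply: (@Rintegral_dominated_cvg _ _ (fun x => C * `|w x|)) => //.
- by move=> n; exact: measurable_funM.
- by apply: aeW => x; rewrite -(mulr0 (w x)); apply: cvgM;
    [exact: cvg_cst|exact: u_0].
- exact/RintegrableZl/Rintegrable_norm.
- by move=> n x; rewrite normrM mulrC ler_wpM2r.
Qed.

Lemma Rintegral_fatou (f_ : nat -> T -> R) f C :
  (forall n x, 0 <= f_ n x) -> (forall n, Rintegrable (f_ n)) ->
  (forall n, \int[mu]_x f_ n x <= C) -> (forall x, f_ ^~ x @ \oo --> f x) ->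
  Rintegrable f /\ \int[mu]_x f x <= C.
Proof.
move=> f_0 if_ f_C f_f.
have mf : measurable_fun setT f.
  apply: (measurable_fun_cvg (h := f_)) => [n|x _]; last exact: f_f.
  exact: Rintegrable_measurable.
have f0 x : 0 <= f x.
  by apply: (ler_cvg_to (cvg_cst 0) (f_f x)); exact: nearW.
have fC : (\int[mu]_x (f x)%:E <= C%:E)%E.
  have -> : (\int[mu]_x (f x)%:E = \int[mu]_x limn_einf (EFin \o f_ ^~ x))%E.
    apply: eq_integral => x _; have cx : EFin \o f_ ^~ x @ \oo --> (f x)%:E.
      exact: cvg_comp (f_f x) _.
    rewrite is_cvg_limn_einfE; first by apply/esym/cvg_lim.
    by apply/cvg_ex; exists (f x)%:E.
  have mf_ n : measurable_fun setT (EFin \o f_ n).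
    by apply/measurable_EFinP; exact: Rintegrable_measurable.
  apply: le_trans (fatou mu measurableT mf_ _) _.
    by move=> n x _; rewrite lee_fin.
  rewrite limn_einf_lim; apply: lime_le; first exact: is_cvg_einfs.
  apply: nearW => n; apply: (@le_trans _ _ (\int[mu]_x (f_ n x)%:E)%E).
    by apply: ereal_inf_lbound; exists n => /=.
  by rewrite -[leLHS]fineK ?lee_fin ?f_C//; exact: integrable_fin_num (if_ n).
have fi : Rintegrable f.
  apply/integrableP; split; first exact/measurable_EFinP.
  by under eq_integral do rewrite /= ger0_norm//;
    exact: le_lt_trans fC (ltry C).
by split=> //; rewrite -lee_fin fineK//; exact: integrable_fin_num fi.
Qed.

Lemma is_derive_under_Rintegral A (f f' : R -> T -> R) g (y : R) :
  measurable A -> (forall x, mu.-integrable A (EFin \o f x)) ->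
  (forall (x : R) t, A t -> is_derive x 1 (f^~ t) (f' x t)) ->
  mu.-integrable A (EFin \o g) -> (forall x t, A t -> `|f' x t| <= g t) ->
  is_derive y 1 (fun x => \int[mu]_(t in A) f x t)
    (\int[mu]_(t in A) f' y t).
Proof.
move=> mA fi df ig f'g.
have d1f x t : A t -> partial1of2 f x t = f' x t.
  by move=> At; rewrite partial1of2E (@derive_val _ _ _ _ _ _ _ (df x t At)).
have yI : `]y - 1, y + 1[%classic y.
  by rewrite /= in_itv /= ltrBlDr ltrDl ltr01.
have fi' x : `]y - 1, y + 1[%classic x -> mu.-integrable A (EFin \o f x).
  by move=> _; exact: fi.
have df' x t : `]y - 1, y + 1[%classic x -> A t -> derivable (f^~ t) x 1.
  by move=> _ At; have [] := df x t At.
have g0 t : 0 <= `|g t| by [].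
have ig' := integrable_norm ig.
have d1g x t : `]y - 1, y + 1[%classic x -> A t ->
    `|partial1of2 f x t| <= `|g t|.
  by move=> _ At; rewrite d1f//; apply: le_trans (f'g x t At) (ler_norm _).
split; first exact: (derivable_under_integral mA yI fi' df' g0 ig' d1g).
rewrite -derive1E (differentiation_under_integral mA yI fi' df' g0 ig' d1g).
by apply: eq_Rintegral => t; rewrite inE => At; exact: d1f.
Qed.

End RealIntegrals.

Section Fubini.
Context {d1 d2} {T1 : measurableType d1} {T2 : measurableType d2}.
Context {R : realType}.
Variables (mu : {sigma_finite_measure set T1 -> \bar R}).
Variables (nu : {sigma_finite_measure set T2 -> \bar R}).
Variables (h : T1 -> R) (m : T1 -> T2 -> R) (A : set T2) (C : R).
Hypotheses (mA : measurable A) (Afin : (nu A < +oo)%E).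
Hypothesis ih : Rintegrable mu h.
Hypothesis mm : measurable_fun setT (fun z : T1 * T2 => m z.1 z.2).
Hypothesis mC : forall x t, A t -> `|m x t| <= C.

Let F (z : T1 * T2) : \bar R := (h z.1 * (m z.1 z.2 * \1_A z.2))%:E.

Let mF : measurable_fun setT F.
Proof.
apply/measurable_EFinP; apply: measurable_funM.
  exact: measurableT_comp (Rintegrable_measurable ih) measurable_fst.
by apply: measurable_funM => //; exact: measurableT_comp measurable_snd.
Qed.

Let measurable_section x : measurable_fun setT (m x).
Proof. exact: (measurableT_comp mm (measurable_pair1 x)). Qed.

Let integrable_section x : nu.-integrable A (EFin \o m x).
Proof.
apply: bounded_integrable => [//|//||t]; last exact: mC.
by apply: measurable_funTS; exact: measurable_section.
Qed.

Let integral_section x :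
  (\int[nu]_t F (x, t) = (h x * \int[nu]_(t in A) m x t)%:E)%E.
Proof.
rewrite EFinM /Rintegral fineK; last first.
  exact: (integrable_fin_num mA (integrable_section x)).
rewrite -(integralZl mA (integrable_section x)) [RHS]integral_mkcond;
  apply: eq_integral => t _.
by rewrite patchE /F /= indicE; case: (_ \in _); rewrite ?mulr1 ?mulr0.
Qed.

Let integrable_product : (mu \x nu)%E.-integrable setT F.
Proof.
apply/(integrable12ltyP _ _ mF).
have bound x : (\int[nu]_t `|F (x, t)| <= (`|h x| * (C * fine (nu A)))%:E)%E.
  have -> : (\int[nu]_t `|F (x, t)| = \int[nu]_(t in A) `|(h x * m x t)%:E|)%E.
    rewrite [RHS]integral_mkcond; apply: eq_integral => t _.
    rewrite patchE /F /= indicE.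
    by case: (_ \in _); rewrite ?mulr1 ?mulr0 ?normr0.
  have hC0 : A !=set0 -> 0 <= `|h x| * C.
    by move=> [t At]; rewrite mulr_ge0//; exact: le_trans (mC x At).
  have [->|/set0P/hC0 hx0] := eqVneq A set0.
    by rewrite integral_set0 measure0 mulr0 mulr0.
  rewrite mulrA EFinM fineK; last by rewrite ge0_fin_numE.
  apply: integral_le_bound => //.
    by apply/measurable_EFinP/measurable_funM => //; exact: measurable_funTS.
  by apply: aeW => t At; rewrite lee_fin normrM ler_wpM2l//; exact: mC.
apply: (@le_lt_trans _ _
    (\int[mu]_x (`|h x| * (C * fine (nu A)))%:E)%E); last first.
  have ihn := Rintegrable_norm ih.
  have := integrableZr measurableT (C * fine (nu A)) ihn.
  exact: (integrable_lty measurableT).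
apply: ge0_le_integral => //.
- by move=> x _; apply: integral_ge0.
- apply: (@measurable_fun_fubini_tonelli_F _ _ _ _ _ nu (abse \o F)).
    exact: measurableT_comp.
  by move=> x; exact: abse_ge0.
- apply/measurable_EFinP/measurable_funM => //.
  exact: Rintegrable_measurable (Rintegrable_norm ih).
Qed.

Lemma Rintegral_fubini :
  \int[mu]_x (h x * \int[nu]_(t in A) m x t) =
  \int[nu]_(t in A) \int[mu]_x (h x * m x t).
Proof.
rewrite /Rintegral [X in _ = fine X]integral_mkcond.
under eq_integral do rewrite -integral_section.
rewrite (Fubini integrable_product); congr fine; apply: eq_integral => t _.
rewrite patchE /F /= indicE; case: ifPn => At /=; last first.
  by under eq_integral do rewrite !mulr0; rewrite integral0.
under eq_integral do rewrite mulr1.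
rewrite fineK//; apply: integrable_fin_num => //.
apply: (@Rintegrable_mul_bounded _ _ _ _ _ _ C) => [//||x].
  exact: (measurableT_comp mm (measurable_pair2 t)).
by apply: mC; exact: set_mem.
Qed.

End Fubini.

(* Instance resolution does not see that Lebesgue measure is a measure on a ring
   of sets. *)
#[local] Instance ae_lebesgue_filter (R : realType) :
  Filter (nbhs (almost_everywhere (@lebesgue_measure R))) :=
  ae_filter_ringOfSetsType lebesgue_measure.

Section LebesgueIntervals.
Variable R : realType.
Local Notation leb := (@lebesgue_measure R).
Implicit Types (f F : R -> R) (a b C : R).

Lemma lebesgue_measure_itvcc_lty a b : (leb `[a, b] < +oo)%E.
Proof.
by rewrite lebesgue_measure_itv /=; case: ifP => _; rewrite -?EFinB ltry.
Qed.

Lemma fine_lebesgue_measure_itvcc a b : a <= b -> fine (leb `[a, b]) = b - a.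
Proof.
move=> ab; rewrite lebesgue_measure_itv /= lte_fin; case: ltgtP ab => //= -> _.
by rewrite subrr.
Qed.

Lemma itv_bounded_integrable f a b C : measurable_fun `[a, b] f ->
  (forall x, x \in `[a, b] -> `|f x| <= C) ->
  leb.-integrable `[a, b] (EFin \o f).
Proof.
move=> mf fC; apply: (@bounded_integrable _ _ _ leb _ _ C) => //.
exact: lebesgue_measure_itvcc_lty.
Qed.

Lemma ler_norm_Rintegral_itv f a b C : a <= b -> measurable_fun `[a, b] f ->
  (forall x, x \in `[a, b] -> `|f x| <= C) ->
  `|\int[leb]_(x in `[a, b]) f x| <= C * (b - a).
Proof.
move=> ab mf fC; rewrite -fine_lebesgue_measure_itvcc//.
by apply: ler_norm_Rintegral_bounded => //; exact: lebesgue_measure_itvcc_lty.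
Qed.

Lemma is_derive_continuous f (f' : R -> R) :
  (forall x : R, is_derive x 1 f (f' x)) -> continuous f.
Proof.
move=> df x; apply/differentiable_continuous/derivable1_diffP.
by have [] := df x.
Qed.

Lemma Rintegral_FTC f F a b : a <= b ->
  (forall x : R, is_derive x 1 F (f x)) -> continuous f ->
  \int[leb]_(x in `[a, b]) f x = F b - F a.
Proof.
rewrite le_eqVlt => /predU1P[->|ab] dF cf.
  by rewrite set_itv1 Rintegral_set1 subrr.
have cF := is_derive_continuous dF.
rewrite /Rintegral (@continuous_FTC2 _ f F)//.
- exact: continuous_subspaceT.
- split; first by move=> x _; have [] := dF x.
    exact/cvg_at_right_filter/cF.
  exact/cvg_at_left_filter/cF.
- by move=> x _; rewrite derive1E; exact: derive_val.
Qed.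

Lemma continuous_locally_integrable f :
  continuous f -> locally_integrable setT f.
Proof.
move=> cf; split=> [||K _ cK]; last 1 first.
- have /integrableP[]// : leb.-integrable K (EFin \o f).
  by apply: continuous_compact_integrable => //; exact: continuous_subspaceT.
- exact: continuous_measurable_fun.
- exact: openT.
Qed.

Lemma continuous_itv_integrable f a b :
  continuous f -> leb.-integrable `[a, b] (EFin \o f).
Proof.
move=> cf; apply: continuous_compact_integrable; first exact: segment_compact.
exact: continuous_subspaceT.
Qed.

Lemma ae_eq0_Rintegral_itv f : locally_integrable setT f ->
  (forall a b, a < b -> \int[leb]_(x in `[a, b]) f x = 0) ->
  {ae leb, forall x, f x = 0}.
Proof.
move=> lf f0; have [mf _ finf] := lf.
have fi a b : leb.-integrable `[a, b] (EFin \o f).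
  apply/integrableP; split; last by apply: finf => //; exact: segment_compact.
  by apply/measurable_EFinP; exact: measurable_funTS.
have f0_right (n : nat) : {ae leb, forall x, - n%:R < x -> f x = 0}.
  apply: filterS (FTC1 (fi (- n%:R)) lf) => x /= + nx.
  rewrite lte_fin nx => /(_ isT)[_ <-].
  rewrite derive1E -(@derive_cst _ _ R^o (0 : R) x 1).
  apply: near_eq_derive; near=> y; rewrite f0//; near: y.
  exact: lt_nbhsr.
have := ae_foralln f0_right; apply: filterS => x fx.
apply: (fx (Num.trunc `|x|).+1).
by rewrite ltrNl; apply: le_lt_trans (truncnS_gt _); rewrite -normrN ler_norm.
Unshelve. all: end_near. Qed.

End LebesgueIntervals.

Lemma cvg_harmonic_dist (R : realType) (u : nat -> R) (l C : R) :
  (forall n, `|u n - l| <= C * n.+1%:R^-1) -> u @ \oo --> l.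
Proof.
move=> ul; apply/subr_cvg0/norm_cvg0P.
have harmonic_cvg : C * n.+1%:R^-1 @[n --> \oo] --> (0 : R).
  by rewrite -(mulr0 C); apply: cvgM; [exact: cvg_cst|exact: cvg_harmonic].
apply: squeeze_cvgr (cvg_cst 0) harmonic_cvg.
by apply: nearW => n; rewrite normr_ge0 ul.
Qed.

Section Derivatives.
Variable R : realType.
Implicit Types (f : R -> R) (x y z K : R).

Lemma MVT_between f (f' : R -> R) x y :
  (forall x : R, is_derive x 1 f (f' x)) ->
  exists2 c, `|x - c| <= `|x - y| & f x - f y = f' c * (x - y).
Proof.
move=> df; have cf := is_derive_continuous df.
have [xy|yx] := leP x y.
  have [c] := MVT_segment xy (fun x _ => df x) (continuous_subspaceT cf).
  rewrite in_itv /= => /andP[xc cy] e; exists c.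
    by rewrite distrC ger0_norm ?subr_ge0// distrC ger0_norm ?subr_ge0// lerD2r.
  by rewrite -opprB e -mulrN opprB.
have [c] := MVT_segment (ltW yx) (fun x _ => df x) (continuous_subspaceT cf).
rewrite in_itv /= => /andP[yc cx] e; exists c => //.
by rewrite !ger0_norm ?subr_ge0 ?(ltW yx)// lerD2l lerN2.
Qed.

Lemma is_derive_lipschitz f (f' : R -> R) K :
  (forall x : R, is_derive x 1 f (f' x)) -> (forall x, `|f' x| <= K) ->
  forall x y, `|f x - f y| <= K * `|x - y|.
Proof.
move=> df f'K x y; have [c _ ->] := MVT_between x y df.
by rewrite normrM ler_wpM2r.
Qed.

End Derivatives.

Lemma continuous_limit_point_zeros (R : realType) (f : R -> R) z :
  continuous f -> limit_point [set x | f x = 0] z -> f z = 0.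
Proof.
move=> cf lz; apply: contrapT => /eqP fz0.
by have [y [_ /= /eqP fy /negP]] := lz _ (cvgr_neq0 _ (cf z) fz0).
Qed.

Section DerivativeChain.
Variables (R : realType) (F : nat -> R -> R).
Hypothesis dF : forall n (x : R), is_derive x 1 (F n) (F n.+1 x).
Local Notation zeros n := [set x | F n x = 0].

Let continuous_chain n : continuous (F n).
Proof. exact: is_derive_continuous (dF n). Qed.

(* The sum is a function of z whose derivative is the last term of its
   differentiated form; the mean value theorem does the rest. *)
Lemma taylor_cauchy_remainder m x z : exists2 c, `|x - c| <= `|x - z| &
  F 0 x = \sum_(k < m.+1) F k z * (x - z) ^+ k / k`!%:R +
    F m.+1 c * (x - c) ^+ m / m`!%:R * (x - z).
Proof.
pose G m (t : R) := \sum_(k < m.+1) F k t * (x - t) ^+ k / k`!%:R.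
have dG k (t : R) : is_derive t 1 (G k) (F k.+1 t * (x - t) ^+ k / k`!%:R).
  elim: k => [|k IHk].
    have -> : G 0 = F 0.
      by apply/funext => u; rewrite /G big_ord1 expr0 mulr1 divr1.
    by rewrite expr0 mulr1 divr1; exact: dF.
  have -> : G k.+1 =
      G k + (k.+1`!%:R^-1 \*: (F k.+1 * (fun u => (x - u) ^+ k.+1))).
    apply/funext => u; rewrite /G big_ord_recr; congr (_ + _).
    by rewrite /= mulrC.
  have dFt := dF k.+1 t.
  have dX : is_derive t 1 (fun u => (x - u) ^+ k.+1)
    (- (k.+1%:R * (x - t) ^+ k)).
    have dB := is_deriveB (is_derive_cst x t 1) (is_derive_id t 1).
    have := is_deriveX k.+1 dB; rewrite exprfctE => dXk.
    by apply: (is_derive_eq dXk); rewrite /GRing.scale /= !fctE; ring.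
  apply: (is_derive_eq (is_deriveD IHk (is_deriveZ _ (is_deriveM dFt dX)))).
  rewrite /GRing.scale /= factS natrM.
  have k0 : k`!%:R != 0 :> R by rewrite pnatr_eq0 -lt0n fact_gt0.
  by field; rewrite k0 nat1r pnatr_eq0.
have [c cxz e] := MVT_between x z (dG m); exists c => //.
rewrite -e addrC subrK /G big_ord_recl subrr expr0 mulr1 divr1 big1 ?addr0//.
by move=> k _; rewrite expr0n /= mulr0 mul0r.
Qed.

Lemma limit_point_zeros_derivative n z :
  limit_point (zeros n) z -> limit_point (zeros n.+1) z.
Proof.
move=> lz; have Fz := continuous_limit_point_zeros (@continuous_chain n) lz.
have rolle a b : a < b -> F n a = F n b ->
    exists2 c, c \in `]a, b[ & F n.+1 c = 0.
  move=> ab Fab; have [||c cab dFc] := Rolle ab _ _ Fab.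
  - by move=> x _; have [] := dF n x.
  - exact/continuous_subspaceT/continuous_chain.
  exists c => //; rewrite -(@derive_val _ _ _ _ _ _ _ (dF n c)).
  exact: (@derive_val _ _ _ _ _ _ _ dFc).
move=> U /nbhs_ballP[e /= e0 zeU].
have [y [yz /= Fy yze]] := lz _ (nbhsx_ballx z _ e0).
have [c [cz cy] Fc] : exists2 c, c != z /\ `|z - c| <= `|z - y| & F n.+1 c = 0.
  have [zy|yz'|yz'] := ltgtP z y; last by rewrite yz' eqxx in yz.
  - have [|c] := rolle z y zy; first by rewrite Fz Fy.
    rewrite in_itv /= => /andP[zc cy] Fc; exists c => //; split;
      first by rewrite gt_eqF.
    by rewrite !ler0_norm ?subr_le0 ?ltW//; lra.
  - have [|c] := rolle y z yz'; first by rewrite Fz Fy.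
    rewrite in_itv /= => /andP[yc cz] Fc; exists c => //; split;
      first by rewrite lt_eqF.
    by rewrite !ger0_norm ?subr_ge0 ?ltW//; lra.
by exists c; split => //; apply: zeU; exact: le_lt_trans yze.
Qed.

Lemma limit_point_zeros_derivatives z : limit_point (zeros 0) z ->
  forall n, F n z = 0.
Proof.
move=> lz n; apply: continuous_limit_point_zeros (@continuous_chain n) _.
by elim: n => // n; exact: limit_point_zeros_derivative.
Qed.

Section ExponentialType.
Variables A s : R.
Hypothesis FA : forall n x, `|F n x| <= A * s ^+ n.

Lemma limit_point_zeros_eq0 z : limit_point (zeros 0) z -> forall x, F 0 x = 0.
Proof.
move=> /limit_point_zeros_derivatives Fz x.
have FM m : `|F 0 x| <= A * s * `|x - z| * exp_coeff (s * `|x - z|) m.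
  have [c cxz ->] := taylor_cauchy_remainder m x z.
  rewrite big1 ?add0r => [|k _]; last by rewrite Fz !mul0r.
  rewrite !normrM normrX normfV [X in _ / X]ger0_norm//.
  have -> : A * s * `|x - z| * exp_coeff (s * `|x - z|) m =
      A * s ^+ m.+1 * `|x - z| ^+ m / m`!%:R * `|x - z|.
    by rewrite exp_coeffE exprMn exprS; ring.
  rewrite ler_wpM2r// ler_wpM2r ?invr_ge0// ler_pM//.
  by rewrite lerXn2r ?nnegrE.
have : `|F 0 x| <= 0.
  have cv : A * s * `|x - z| * exp_coeff (s * `|x - z|) m @[m --> \oo] -->
    (0 : R).
    rewrite -[X in _ --> X](mulr0 (A * s * `|x - z|)).
    by apply: cvgM; [exact: cvg_cst|exact: cvg_exp_coeff].
  by apply: ler_cvg_to (cvg_cst _) cv _; exact: nearW.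
by rewrite normr_le0 => /eqP.
Qed.

Lemma countable_zeros : (exists x, F 0 x <> 0) -> countable (zeros 0).
Proof.
move=> [x Fx0]; apply: sub_countable (countable_isolated (zeros 0)).
apply: subset_card_le => y /subset_closure.
rewrite closure_isolated_limit_point => -[//|/limit_point_zeros_eq0 F0].
by rewrite F0 in Fx0.
Qed.

End ExponentialType.

End DerivativeChain.

Section CosineIntegrals.
Variable R : realType.
Local Notation leb := (@lebesgue_measure R).
Implicit Types (A : set R) (w : R -> R) (c u : R).

Lemma measurable_cos : measurable_fun setT (@cos R).
Proof. exact: continuous_measurable_fun (@continuous_cos R). Qed.

Lemma measurable_cos_affine c u :
  measurable_fun setT (fun t => cos (u * t + c)).
Proof.
apply: (measurableT_comp measurable_cos).
by apply: measurable_funD => //; exact: measurable_funM.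
Qed.

Definition cosint A w c u : R := \int[leb]_(t in A) (w t * cos (u * t + c)).

Section Bounds.
Variables (A : set R) (w : R -> R) (W : R).
Hypotheses (mA : measurable A) (Afin : (leb A < +oo)%E).
Hypothesis mw : measurable_fun setT w.
Hypothesis wW : forall t, A t -> `|w t| <= W.

Lemma cosint_integrand_le c u t : A t -> `|w t * cos (u * t + c)| <= W.
Proof. by move=> At; rewrite normrM -[leRHS]mulr1 ler_pM ?wW ?cos_max. Qed.

Lemma measurable_cosint_integrand c u :
  measurable_fun setT (fun t => w t * cos (u * t + c)).
Proof. by apply: measurable_funM => //; exact: measurable_cos_affine. Qed.

Lemma integrable_cosint c u :
  leb.-integrable A (EFin \o (fun t => w t * cos (u * t + c))).
Proof.
apply: (@bounded_integrable _ _ _ _ _ _ W) => //;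
  last exact: cosint_integrand_le.
by apply: measurable_funTS; exact: measurable_cosint_integrand.
Qed.

Lemma ler_norm_cosint c u : `|cosint A w c u| <= W * fine (leb A).
Proof.
apply: ler_norm_Rintegral_bounded => //; last exact: cosint_integrand_le.
by apply: measurable_funTS; exact: measurable_cosint_integrand.
Qed.

Variable M : R.
Hypothesis AM : forall t, A t -> `|t| <= M.

Lemma is_derive_cosint c u : is_derive u 1 (cosint A w c)
  (cosint A (fun t => w t * t) (c + pi / 2) u).
Proof.
apply: (@is_derive_under_Rintegral _ _ _ leb A
  (fun u t => w t * cos (u * t + c))
  (fun u t => w t * t * cos (u * t + (c + pi / 2))) (cst (W * M))) => //.
- by move=> v; exact: integrable_cosint.
- move=> v t _; have dcos : is_derive v 1 (fun v => cos (v * t + c))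
    (- sin (v * t + c) * t).
    by apply: is_derive_eq; rewrite scaler0 add0r addr0 /GRing.scale /= mulr1.
  apply: (is_derive_eq (is_deriveZ (w t) dcos)).
  by rewrite addrA cosDpihalf /GRing.scale /=; ring.
- by apply: (@bounded_integrable _ _ _ _ _ _ `|W * M|).
- move=> v t At; rewrite -mulrA normrM ler_pM ?wW// normrM -[leRHS]mulr1.
  by rewrite ler_pM ?cos_max ?AM.
Qed.

Lemma continuous_cosint c : continuous (cosint A w c).
Proof. exact: is_derive_continuous (is_derive_cosint c). Qed.

Lemma measurable_cosint c : measurable_fun setT (cosint A w c).
Proof. exact: continuous_measurable_fun (@continuous_cosint c). Qed.

End Bounds.

Lemma cosintB A w (v : R -> R) W V c u : measurable A -> (leb A < +oo)%E ->
  measurable_fun setT w -> (forall t, A t -> `|w t| <= W) ->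
  measurable_fun setT v -> (forall t, A t -> `|v t| <= V) ->
  cosint A (fun t => w t - v t) c u = cosint A w c u - cosint A v c u.
Proof.
move=> mA Afin mw wW mv vV; rewrite /cosint -RintegralB//; first last.
- exact: integrable_cosint vV c u.
- exact: integrable_cosint wW c u.
by apply: eq_Rintegral => t _; rewrite mulrBl.
Qed.

End CosineIntegrals.

Section Convolution.
Variable R : realType.
Local Notation leb := (@lebesgue_measure R).
Implicit Types (h k l : R -> R) (x y K L : R).

Definition conv h k y : R := \int[leb]_x (h x * k (y - x)).

Lemma measurable_translate_reflect k y :
  measurable_fun setT k -> measurable_fun setT (fun x => k (y - x)).
Proof. by move=> mk; apply: measurableT_comp => //; exact: measurable_funB. Qed.

Lemma Rintegrable_conv h k K y : Rintegrable leb h -> measurable_fun setT k ->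
  (forall u, `|k u| <= K) -> Rintegrable leb (fun x => h x * k (y - x)).
Proof.
move=> ih mk kK; apply: Rintegrable_mul_bounded ih _ (fun x => kK (y - x)).
exact: measurable_translate_reflect.
Qed.

Lemma ler_norm_conv h k K y : Rintegrable leb h -> measurable_fun setT k ->
  (forall u, `|k u| <= K) -> `|conv h k y| <= K * \int[leb]_x `|h x|.
Proof.
move=> ih mk kK.
apply: ler_norm_Rintegral_mul_bounded ih _ (fun x => kK (y - x)).
exact: measurable_translate_reflect.
Qed.

Lemma convB h k l K L y : Rintegrable leb h ->
  measurable_fun setT k -> (forall u, `|k u| <= K) ->
  measurable_fun setT l -> (forall u, `|l u| <= L) ->
  conv h (fun u => k u - l u) y = conv h k y - conv h l y.
Proof.
move=> ih mk kK ml lK; rewrite /conv -RintegralB//; first last.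
- exact: Rintegrable_conv ml lK.
- exact: Rintegrable_conv mk kK.
by apply: eq_Rintegral => x _; rewrite mulrBr.
Qed.

Lemma is_derive_conv h k (k' : R -> R) K L y : Rintegrable leb h ->
  (forall u, `|k u| <= K) -> (forall u : R, is_derive u 1 k (k' u)) ->
  (forall u, `|k' u| <= L) -> is_derive y 1 (conv h k) (conv h k' y).
Proof.
move=> ih kK dk k'L.
have mk := continuous_measurable_fun (is_derive_continuous dk).
apply: (@is_derive_under_Rintegral _ _ _ leb setT
  (fun y x => h x * k (y - x)) (fun y x => h x * k' (y - x))
  (fun x => L * `|h x|)) => //.
- by move=> z; exact: Rintegrable_conv mk kK.
- move=> z x _; have dB := is_deriveB (is_derive_id z 1) (is_derive_cst x z 1).
  have dkz : is_derive z 1 (fun z => k (z - x)) (k' (z - x) * (1 - 0)).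
    exact: (@is_derive1_comp _ k (id - cst x) _ _ _ (dk (z - x)) dB).
  by apply: (is_derive_eq (is_deriveZ (h x) dkz)); rewrite subr0 mulr1.
- exact/RintegrableZl/Rintegrable_norm.
- by move=> z x _; rewrite normrM mulrC ler_wpM2r.
Qed.

Lemma Rintegral_itv_conv h k K (a b : R) : Rintegrable leb h ->
  measurable_fun setT k -> (forall u, `|k u| <= K) ->
  \int[leb]_(y in `[a, b]) conv h k y =
  \int[leb]_x (h x * \int[leb]_(y in `[a, b]) k (y - x)).
Proof.
move=> ih mk kK; rewrite (@Rintegral_fubini _ _ _ _ _ leb leb _
  (fun x y => k (y - x)) _ K)//.
- exact: lebesgue_measure_itvcc_lty.
- apply: (measurableT_comp mk).
  by apply: measurable_funB; [exact: measurable_snd|exact: measurable_fst].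
Qed.

Definition cos_transform h c (t : R) : R := \int[leb]_x (h x * cos (c - x * t)).

Lemma measurable_cosB c (t : R) :
  measurable_fun setT (fun x => cos (c - x * t)).
Proof.
have := measurable_cos_affine c (- t).
by congr measurable_fun; apply/funext => x; congr cos; ring.
Qed.

Lemma Rintegrable_mul_cos h c (t : R) : Rintegrable leb h ->
  Rintegrable leb (fun x => h x * cos (c - x * t)).
Proof.
by move=> ih; apply: (Rintegrable_mul_bounded ih (measurable_cosB c t)) => x;
  exact: cos_max.
Qed.

Lemma conv_cosint h (A : set R) (w : R -> R) W c y :
  measurable A -> (leb A < +oo)%E -> Rintegrable leb h ->
  measurable_fun setT w -> (forall t, A t -> `|w t| <= W) ->
  conv h (cosint A w c) y =
  \int[leb]_(t in A) (w t * cos_transform h (y * t + c) t).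
Proof.
move=> mA Afin ih mw wW; rewrite /conv /cosint.
rewrite (@Rintegral_fubini _ _ _ _ _ leb leb _
  (fun x t => w t * cos ((y - x) * t + c)) _ W)//; first last.
- by move=> x t At; exact: (cosint_integrand_le wW c (y - x) At).
- apply: measurable_funM; first exact: measurableT_comp mw measurable_snd.
  apply: (measurableT_comp (@measurable_cos R)).
  apply: measurable_funD => //; apply: measurable_funM;
    last exact: measurable_snd.
  by apply: measurable_funB => //; exact: measurable_fst.
apply: eq_Rintegral => t _.
rewrite /cos_transform -RintegralZl//; last exact: Rintegrable_mul_cos.
by apply: eq_Rintegral => x _; rewrite mulrCA; congr (_ * (_ * cos _)); ring.
Qed.

Lemma is_derive_conv_cosint h (A : set R) (w : R -> R) W M c y :
  measurable A -> (leb A < +oo)%E -> Rintegrable leb h ->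
  measurable_fun setT w -> (forall t, A t -> `|w t| <= W) ->
  (forall t, A t -> `|t| <= M) ->
  is_derive y 1 (conv h (cosint A w c))
    (conv h (cosint A (fun t => w t * t) (c + pi / 2)) y).
Proof.
move=> mA Afin ih mw wW AM.
apply: is_derive_conv ih (ler_norm_cosint mA Afin mw wW c)
  (is_derive_cosint mA Afin mw wW AM c) (ler_norm_cosint mA Afin _ _ _).
  exact: measurable_funM.
by move=> t At; rewrite normrM; exact: ler_pM (wW t At) (AM t At).
Qed.

End Convolution.

Section Bandlimited.
Variable R : realType.
Local Notation leb := (@lebesgue_measure R).
Implicit Types (h w : R -> R) (s c t y : R) (A : set R).

Definition bandlimited s h : Prop := Rintegrable leb h /\
  forall c t, s < t -> cos_transform h c t = 0.

Lemma bandlimited_conv_cosint_eq0 s h A w W c y : bandlimited s h ->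
  measurable A -> (leb A < +oo)%E ->
  measurable_fun setT w -> (forall t, A t -> `|w t| <= W) ->
  (forall t, A t -> s < t) -> conv h (cosint A w c) y = 0.
Proof.
move=> [ih h0] mA Afin mw wW As; rewrite (conv_cosint c y mA Afin ih mw wW).
by apply: Rintegral_eq0 => t /As st; rewrite h0 ?mulr0.
Qed.

End Bandlimited.

Section PoissonKernel.
Variable R : realType.
Local Notation leb := (@lebesgue_measure R).
Implicit Types (e u x : R).

Definition damping e (t : R) : R := expR (- e * t).

Definition poisson e u : R := e / (e ^+ 2 + u ^+ 2).

Lemma poisson_denom_gt0 e u : 0 < e -> 0 < e ^+ 2 + u ^+ 2.
Proof. by move=> e0; rewrite ltr_wpDr ?sqr_ge0 ?exprn_gt0. Qed.

Lemma ler_norm_poisson e u : 0 < e -> `|poisson e u| <= e^-1.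
Proof.
move=> e0; have d0 := poisson_denom_gt0 u e0.
rewrite ger0_norm /poisson; last by rewrite divr_ge0// ltW.
rewrite ler_pdivrMr// mulrDr expr2 mulKf ?gt_eqF// lerDl.
by rewrite mulr_ge0 ?sqr_ge0// invr_ge0 ltW.
Qed.

Lemma continuous_poisson e : 0 < e -> continuous (poisson e).
Proof.
move=> e0 u; apply: cvgM; first exact: cvg_cst.
apply: cvgV; first by rewrite gt_eqF// poisson_denom_gt0.
by apply: cvgD; [exact: cvg_cst|exact: exprn_continuous].
Qed.

Lemma measurable_damping e : measurable_fun setT (damping e).
Proof.
by apply: (measurableT_comp (@measurable_expR R)); exact: measurable_funM.
Qed.

Lemma damping_le1 e t : 0 <= e -> 0 <= t -> `|damping e t| <= 1.
Proof.
move=> e0 t0; rewrite ger0_norm ?expR_ge0//.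
by rewrite -expR0 ler_expR mulNr oppr_le0 mulr_ge0.
Qed.

Lemma cosint_damping e u (T : R) : 0 < e -> 0 <= T ->
  cosint `[0, T] (damping e) 0 u =
  poisson e u +
  damping e T * ((u * sin (u * T) - e * cos (u * T)) / (e ^+ 2 + u ^+ 2)).
Proof.
move=> e0 T0.
have d0 : e ^+ 2 + u ^+ 2 != 0 by rewrite gt_eqF ?poisson_denom_gt0.
pose F t :=
  damping e t * ((u * sin (u * t) - e * cos (u * t)) / (e ^+ 2 + u ^+ 2)).
have dF (t : R) : is_derive t 1 F (damping e t * cos (u * t + 0)).
  by apply: is_derive_eq; rewrite /GRing.scale /= addr0 /damping; field.
have cf : continuous (fun t => damping e t * cos (u * t + 0)).
  have df (t : R) : is_derive t 1 (fun t => damping e t * cos (u * t + 0))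
      (- damping e t * (e * cos (u * t) + u * sin (u * t))).
    by apply: is_derive_eq; rewrite /GRing.scale /= !addr0 /damping; ring.
  exact: is_derive_continuous df.
rewrite /cosint (Rintegral_FTC T0 dF cf) /F !mulr0 sin0 cos0 /damping.
by rewrite mulr0 expR0 /poisson; field.
Qed.

Lemma cosint_damping_dist_poisson e u (T : R) : 0 < e -> 0 <= T ->
  `|cosint `[0, T] (damping e) 0 u - poisson e u| <= 2 / e * damping e T.
Proof.
move=> e0 T0; rewrite cosint_damping// addrAC subrr add0r.
have d0 := poisson_denom_gt0 u e0.
rewrite normrM [`|damping e T|]ger0_norm ?expR_ge0// mulrC ler_wpM2r
  ?expR_ge0//.
rewrite normrM normfV [`|e ^+ 2 + _|]gtr0_norm// ler_pdivrMr//.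
apply: (@le_trans _ _ (`|u| + e)).
  apply: le_trans (ler_normB _ _) _; rewrite !normrM [`|e|]gtr0_norm//.
  by apply: lerD; rewrite ler_piMr ?sin_max ?cos_max// ltW.
rewrite mulrAC ler_pdivlMr// -[u ^+ 2]real_normK ?num_real//.
by have := normr_ge0 u; nra.
Qed.

Lemma Rintegral_itv_poisson e x (a b : R) : 0 < e -> a <= b ->
  \int[leb]_(y in `[a, b]) poisson e (y - x) =
  atan ((b - x) / e) - atan ((a - x) / e).
Proof.
move=> e0 ab.
have dF (y : R) : is_derive y 1 (fun y => atan ((y - x) / e))
  (poisson e (y - x)).
  have d0 := poisson_denom_gt0 (y - x) e0.
  apply: is_derive_eq; rewrite /GRing.scale /= /poisson.
  by field; rewrite !gt_eqF.
rewrite (Rintegral_FTC ab dF)// => y.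
apply: (@continuous_comp _ _ _ (fun y => y - x));
  last exact: continuous_poisson.
by apply: cvgB; [exact: cvg_id|exact: cvg_cst].
Qed.

Lemma cvg_atan_sg (c : R) :
  atan (c / n.+1%:R^-1) @[n --> \oo] --> Num.sg c * (pi / 2).
Proof.
have pos (k : R) : 0 < k -> atan (k / n.+1%:R^-1) @[n --> \oo] --> (pi / 2 : R).
  move=> k0; apply: cvg_comp (@cvgy_atan R).
  apply/cvgryPge => A; near=> n; rewrite invrK mulrC -ler_pdivrMr//.
  apply: le_trans (_ : n%:R <= _); last by rewrite ler_nat.
  by near: n; exact: nbhs_infty_ger.
have [->|c0|c0] := sgrP c.
- under eq_fun do rewrite mul0r atan0; rewrite mul0r; exact: cvg_cst.
- by rewrite mul1r; exact: pos.
- under eq_fun do rewrite -[_ / _]opprK -mulNr atanN.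
  by rewrite mulN1r; apply: cvgN; apply: pos; rewrite oppr_gt0.
Unshelve. all: end_near. Qed.

Lemma cvg_atan_indic (a b x : R) : a < b -> x != a -> x != b ->
  atan ((b - x) / n.+1%:R^-1) - atan ((a - x) / n.+1%:R^-1) @[n --> \oo] -->
  pi * \1_`[a, b] x.
Proof.
move=> ab xa xb.
suff -> : pi * \1_`[a, b] x =
    Num.sg (b - x) * (pi / 2) - Num.sg (a - x) * (pi / 2) :> R.
  by apply: cvgB; exact: cvg_atan_sg.
have xab : (x \in `[a, b]%classic) = (a < x < b).
  by rewrite mem_setE in_itv /= !le_eqVlt eq_sym (negbTE xa) (negbTE xb).
rewrite indicE xab; case: (ltgtP a x) xa => [ax _|xa _|//].
- case: (ltgtP x b) xb => [xb _|bx _|//].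
    by rewrite gtr0_sg ?subr_gt0// ltr0_sg ?subr_lt0//=; field.
  by rewrite !ltr0_sg ?subr_lt0//= subrr mulr0.
- by rewrite !gtr0_sg ?subr_gt0//= ?subrr ?mulr0//; exact: lt_trans ab.
Qed.

End PoissonKernel.

Section BandlimitedInversion.
Variable R : realType.
Local Notation leb := (@lebesgue_measure R).
Variables (s : R) (h : R -> R).
Hypotheses (s0 : 0 <= s) (bh : bandlimited s h).
Let ih : Rintegrable leb h := bh.1.
Local Notation normh := (\int[leb]_x `|h x|).
Implicit Types (e T a b c y : R) (w : R -> R).

Let itv_norm_le T t : `[0, T]%classic t -> `|t| <= T.
Proof. by rewrite /= in_itv /= => /andP[t0 tT]; rewrite ger0_norm. Qed.

Let fine_leb_itv0 T : 0 <= T -> fine (leb `[0, T]) = T.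
Proof. by move=> T0; rewrite fine_lebesgue_measure_itvcc// subr0. Qed.

Let leb_itv_lty T := lebesgue_measure_itvcc_lty 0 T.

Lemma bandlimited_conv_cosint T w W c y : s <= T ->
  measurable_fun setT w -> (forall t, `[0, T]%classic t -> `|w t| <= W) ->
  conv h (cosint `[0, T] w c) y = conv h (cosint `[0, s] w c) y.
Proof.
move=> sT mw wW.
have wWs t : `[0, s]%classic t -> `|w t| <= W.
  by move=> ts; apply: wW; move: t ts; apply: subset_itvl; rewrite bnd_simp.
have wWsT t : `]s, T]%classic t -> `|w t| <= W.
  by move=> ts; apply: wW; move: t ts; apply: subset_itvr; rewrite bnd_simp.
have m0 r : measurable (`[0, r]%classic : set R) by exact: measurable_itv.
have msT : measurable (`]s, T]%classic : set R) by exact: measurable_itv.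
have sTfin : (leb `]s, T] < +oo)%E.
  by rewrite lebesgue_measure_itv /=; case: ifP => _; rewrite -?EFinB ltry.
have st t : `]s, T]%classic t -> s < t by rewrite /= in_itv /= => /andP[].
apply/eqP; rewrite -subr_eq0 -(convB _ ih
  (measurable_cosint (m0 T) (leb_itv_lty T) mw wW (@itv_norm_le T) c)
  (ler_norm_cosint (m0 T) (leb_itv_lty T) mw wW c)
  (measurable_cosint (m0 s) (leb_itv_lty s) mw wWs (@itv_norm_le s) c)
  (ler_norm_cosint (m0 s) (leb_itv_lty s) mw wWs c)).
apply/eqP.
rewrite -[RHS](bandlimited_conv_cosint_eq0 c y bh msT sTfin mw wWsT st).
congr conv; apply/funext => u; rewrite /cosint Rintegral_itvB ?bnd_simp//.
exact: (integrable_cosint (m0 T) (leb_itv_lty T) mw wW c u).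
Qed.

Let damping_bound e T t : 0 <= e -> `[0, T]%classic t -> `|damping e t| <= 1.
Proof.
by move=> e0; rewrite /= in_itv /= => /andP[t0 _]; exact: damping_le1.
Qed.

Let measurable_cosint_damping e T : 0 <= e ->
  measurable_fun setT (cosint `[0, T] (damping e) 0).
Proof.
move=> e0; apply: (measurable_cosint _ (leb_itv_lty T) (measurable_damping e)
  (fun t => damping_bound e0) (@itv_norm_le T)).
exact: measurable_itv.
Qed.

Let ler_norm_cosint_damping e T u : 0 <= e -> 0 <= T ->
  `|cosint `[0, T] (damping e) 0 u| <= T.
Proof.
move=> e0 T0.
have mT : measurable (`[0, T]%classic : set R) by exact: measurable_itv.
apply: le_trans (ler_norm_cosint mT (leb_itv_lty T) (measurable_damping e)
  (fun t => damping_bound e0) 0 u) _.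
by rewrite mul1r fine_leb_itv0.
Qed.

(* The band limit makes the left-hand side independent of the cut-off T >= s;
   let T -> +oo. *)
Lemma bandlimited_conv_damping e y : 0 < e ->
  conv h (cosint `[0, s] (damping e) 0) y = conv h (poisson e) y.
Proof.
move=> e0; have e0' := ltW e0.
have mP := continuous_measurable_fun (continuous_poisson e0).
have approx T : s <= T ->
    `|conv h (cosint `[0, s] (damping e) 0) y - conv h (poisson e) y| <=
    2 / e * normh * expR (- (e * T)).
  move=> sT; have T0 := le_trans s0 sT.
  rewrite -(bandlimited_conv_cosint 0 y sT (measurable_damping e)
    (fun t => damping_bound e0')).
  rewrite -(convB y ih (measurable_cosint_damping T e0')
    (fun u => ler_norm_cosint_damping u e0' T0) mP
    (fun u => ler_norm_poisson u e0)).
  rewrite mulrAC -mulNr; apply: ler_norm_conv => // [|u].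
    by apply: measurable_funB => //; exact: measurable_cosint_damping.
  exact: cosint_damping_dist_poisson.
have cv : 2 / e * normh * expR (- (e * T)) @[T --> +oo] --> (0 : R).
  rewrite -[X in _ --> X](mulr0 (2 / e * normh)); apply: cvgM;
    first exact: cvg_cst.
  by apply: (@cvg_comp _ _ _ (fun T => e * T)) (@cvgr_expR R);
    exact: gt0_cvgMry.
apply/eqP; rewrite -subr_eq0 -normr_le0.
apply: (ler_cvg_to (cvg_cst _) cv).
by near=> T; apply: approx; near: T; apply: nbhs_pinfty_ge; exact: num_real.
Unshelve. all: end_near. Qed.

Let measurable_poisson e : 0 < e -> measurable_fun setT (poisson e).
Proof.
by move=> e0; exact: continuous_measurable_fun (continuous_poisson e0).
Qed.

Lemma Rintegral_conv_damping e a b : 0 < e -> a <= b ->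
  \int[leb]_(y in `[a, b]) conv h (cosint `[0, s] (damping e) 0) y =
  \int[leb]_x (h x * (atan ((b - x) / e) - atan ((a - x) / e))).
Proof.
move=> e0 ab; under eq_Rintegral do rewrite bandlimited_conv_damping//.
rewrite (Rintegral_itv_conv _ _ ih (measurable_poisson e0)
  (fun u => ler_norm_poisson u e0)).
by apply: eq_Rintegral => x _; rewrite Rintegral_itv_poisson.
Qed.

Let continuous_conv_damping e : 0 <= e ->
  continuous (conv h (cosint `[0, s] (damping e) 0)).
Proof.
move=> e0; apply: is_derive_continuous => y.
apply: (is_derive_conv_cosint 0 y _ (leb_itv_lty s) ih (measurable_damping e)
  (fun t => damping_bound e0) (@itv_norm_le s)).
exact: measurable_itv.
Qed.

Lemma conv_damping_dist e y : 0 <= e ->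
  `|conv h (cosint `[0, s] (damping e) 0) y -
    conv h (cosint `[0, s] (damping 0) 0) y|
  <= e * s ^+ 2 * normh.
Proof.
move=> e0.
have ms : measurable (`[0, s]%classic : set R) by exact: measurable_itv.
rewrite -(convB y ih (measurable_cosint_damping s e0)
  (fun u => ler_norm_cosint_damping u e0 s0)
  (measurable_cosint_damping s (lexx 0))
  (fun u => ler_norm_cosint_damping u (lexx 0) s0)).
apply: ler_norm_conv => // [|u].
  by apply: measurable_funB; exact: measurable_cosint_damping.
rewrite -(cosintB 0 u ms (leb_itv_lty s) (measurable_damping e)
  (fun t => damping_bound e0) (measurable_damping 0)
  (fun t => damping_bound (lexx 0))).
rewrite expr2 mulrA -[X in _ <= _ * X](fine_leb_itv0 s0);
  apply: ler_norm_cosint => //.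
  by apply: measurable_funB; exact: measurable_damping.
move=> t; rewrite /= in_itv /= => /andP[t0 ts].
have := expR_ge1Dx (- e * t); have : damping e t <= 1.
  exact: le_trans (ler_norm _) (damping_le1 e0 t0).
have : e * t <= e * s by rewrite ler_wpM2l.
rewrite /damping oppr0 mul0r expR0 => ? ? ?.
by rewrite distrC ger0_norm ?subr_ge0//; lra.
Qed.

Lemma cvg_Rintegral_conv_damping a b : a <= b ->
  \int[leb]_(y in `[a, b]) conv h (cosint `[0, s] (damping n.+1%:R^-1) 0) y
    @[n --> \oo] -->
  \int[leb]_(y in `[a, b]) conv h (cosint `[0, s] (damping 0) 0) y.
Proof.
move=> ab; apply: (@cvg_harmonic_dist _ _ _ (s ^+ 2 * normh * (b - a))) => n.
have n0 : 0 <= n.+1%:R^-1 :> R by [].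
have ik r : 0 <= r ->
    leb.-integrable `[a, b] (EFin \o conv h (cosint `[0, s] (damping r) 0)).
  by move=> r0; apply/continuous_itv_integrable/continuous_conv_damping.
rewrite -RintegralB//; [|exact: ik|exact: ik].
rewrite [leRHS](_ : _ = n.+1%:R^-1 * s ^+ 2 * normh * (b - a)); last by ring.
apply: ler_norm_Rintegral_itv ab _ (fun y _ => conv_damping_dist y n0).
apply: measurable_funTS; apply: continuous_measurable_fun => y.
by apply: cvgB; exact: continuous_conv_damping.
Qed.

Lemma cvg_Rintegral_atan a b : a < b ->
  \int[leb]_x
    (h x * (atan ((b - x) / n.+1%:R^-1) - atan ((a - x) / n.+1%:R^-1)))
    @[n --> \oo] --> pi * \int[leb]_(x in `[a, b]) h x.
Proof.
move=> ab.
have matan c n : measurable_fun setT (fun x : R => atan ((c - x) / n.+1%:R^-1)).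
  apply: (measurableT_comp (continuous_measurable_fun (@continuous_atan R))).
  by apply: measurable_funM => //; exact: measurable_funB.
have -> : pi * \int[leb]_(x in `[a, b]) h x =
    \int[leb]_x (h x * (pi * \1_`[a, b] x)).
  rewrite -RintegralZl//; last exact: integrableS ih.
  rewrite Rintegral_mkcond; apply: eq_Rintegral => x _.
  by rewrite patchE indicE; case: (x \in _); rewrite ?mulr1 ?mulr0// mulrC.
have mh := Rintegrable_measurable ih.
apply: (@Rintegral_dominated_cvg _ _ _ leb _ _ (fun x => pi * `|h x|)).
- by move=> n; apply: measurable_funM => //; apply: measurable_funB;
    exact: matan.
- by apply: measurable_funM => //; exact: measurable_funM.
- exists [set a; b]; split.
  + by apply: measurableU; exact: measurable_set1.
  + by apply/countable_lebesgue_measure0/finite_set_countable/finite_set2.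
  + move=> x /=; apply: contra_notP => /not_orP[/eqP xa /eqP xb].
    by apply: cvgM; [exact: cvg_cst|exact: cvg_atan_indic].
- exact/RintegrableZl/Rintegrable_norm.
- move=> n x; rewrite normrM mulrC ler_wpM2r// ler_norml.
  have lo c := @atan_gtNpi2 R c; have hi c := @atan_ltpi2 R c.
  have := lo ((b - x) / n.+1%:R^-1); have := hi ((b - x) / n.+1%:R^-1).
  have := lo ((a - x) / n.+1%:R^-1); have := hi ((a - x) / n.+1%:R^-1).
  by move=> ? ? ? ?; apply/andP; split; lra.
Qed.

Lemma bandlimited_inversion_itv a b : a < b ->
  \int[leb]_(y in `[a, b]) conv h (cosint `[0, s] (damping 0) 0) y =
  pi * \int[leb]_(y in `[a, b]) h y.
Proof.
move=> ab; have damped_cvg := cvg_Rintegral_conv_damping (ltW ab).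
have := cvg_Rintegral_atan ab.
under eq_fun do rewrite -Rintegral_conv_damping ?(ltW ab)//.
exact: (cvg_unique _ damped_cvg).
Qed.

End BandlimitedInversion.

Section SmoothRepresentative.
Variable R : realType.
Local Notation leb := (@lebesgue_measure R).
Variables (s : R) (h : R -> R).
Hypotheses (s0 : 0 <= s) (ih : Rintegrable leb h).
Local Notation normh := (\int[leb]_x `|h x|).

(* The n-th derivative of pi^-1 \int_0^s \int h(x) cos ((y - x) t) dx dt with
   respect to y, each differentiation shifting the phase by pi / 2. *)
Definition bl_deriv (n : nat) (y : R) : R :=
  pi^-1 * conv h (cosint `[0, s] (fun t => t ^+ n) (pi / 2 *+ n)) y.

Let m0s : measurable (`[0, s]%classic : set R).
Proof. exact: measurable_itv. Qed.

Let leb_0s := lebesgue_measure_itvcc_lty 0 s.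

Let norm_le t : `[0, s]%classic t -> `|t| <= s.
Proof. by rewrite /= in_itv /= => /andP[t0 ts]; rewrite ger0_norm. Qed.

Let norm_expr_le n t : `[0, s]%classic t -> `|t ^+ n| <= s ^+ n.
Proof. by move=> /norm_le ts; rewrite normrX lerXn2r ?nnegrE. Qed.

Let measurable_expr n : measurable_fun setT (fun t : R => t ^+ n).
Proof. exact: continuous_measurable_fun (@exprn_continuous R n). Qed.

Lemma is_derive_bl_deriv n (y : R) :
  is_derive y 1 (bl_deriv n) (bl_deriv n.+1 y).
Proof.
have -> : bl_deriv n.+1 y = pi^-1 *: conv h
    (cosint `[0, s] (fun t => t ^+ n * t) (pi / 2 *+ n + pi / 2)) y.
  have -> : (fun t => t ^+ n * t) = (fun t => t ^+ n.+1) :> (R -> R).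
    by apply/funext => t; rewrite exprSr.
  by rewrite -(mulrSr (pi / 2) n).
exact: (is_deriveZ pi^-1 (is_derive_conv_cosint (pi / 2 *+ n) y m0s leb_0s ih
  (measurable_expr n) (@norm_expr_le n) norm_le)).
Qed.

Lemma ler_norm_bl_deriv n y :
  `|bl_deriv n y| <= pi^-1 * s * normh * s ^+ n.
Proof.
rewrite normrM gtr0_norm ?invr_gt0 ?pi_gt0// -!mulrA.
rewrite ler_wpM2l ?invr_ge0 ?pi_ge0//.
have := ler_norm_conv y ih (measurable_cosint m0s leb_0s (measurable_expr n)
  (@norm_expr_le n) norm_le (pi / 2 *+ n)) (ler_norm_cosint m0s leb_0s
  (measurable_expr n) (@norm_expr_le n) (pi / 2 *+ n)).
rewrite fine_lebesgue_measure_itvcc// subr0; congr (_ <= _); ring.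
Qed.

Definition bl_rep : R -> R := bl_deriv 0.

Lemma ler_norm_bl_rep y : `|bl_rep y| <= pi^-1 * s * normh.
Proof. by have := ler_norm_bl_deriv 0 y; rewrite expr0 mulr1. Qed.

Lemma bl_rep_lipschitz x y :
  `|bl_rep x - bl_rep y| <= pi^-1 * s * normh * s * `|x - y|.
Proof.
apply: is_derive_lipschitz (is_derive_bl_deriv 0) _ _ _ => z.
exact: ler_norm_bl_deriv 1%N z.
Qed.

Lemma continuous_bl_rep : continuous bl_rep.
Proof. exact: is_derive_continuous (is_derive_bl_deriv 0). Qed.

Lemma bl_rep_neq0_ae : (exists x, bl_rep x <> 0) ->
  {ae leb, forall x, bl_rep x <> 0}.
Proof.
move=> /(countable_zeros is_derive_bl_deriv ler_norm_bl_deriv) zeros_countable.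
exists [set x | bl_rep x = 0]; split; first exact: countable_measurable.
  exact: countable_lebesgue_measure0.
by move=> x /= /contrapT.
Qed.

Lemma bl_rep_ae : bandlimited s h -> {ae leb, forall x, h x = bl_rep x}.
Proof.
move=> bh; have lh : locally_integrable setT h.
  by apply: open_integrable_locally => //; exact: openT.
have lD := locally_integrableB lh
  (continuous_locally_integrable continuous_bl_rep).
suff : {ae leb, forall x, (h \- bl_rep) x = 0}.
  by apply: filterS => x /eqP; rewrite subr_eq0 => /eqP.
apply: ae_eq0_Rintegral_itv lD _ => a b ab.
have conv_rep y : conv h (cosint `[0, s] (damping 0) 0) y = pi * bl_rep y.
  have -> : damping 0 = (fun t => t ^+ 0) :> (R -> R).
    by apply/funext => t; rewrite /damping oppr0 mul0r expR0 expr0.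
  by rewrite /bl_rep /bl_deriv mulrA mulfV ?mul1r// gt_eqF// pi_gt0.
have ir := continuous_itv_integrable a b continuous_bl_rep.
rewrite RintegralB//; last exact: integrableS ih.
apply/eqP; rewrite subr_eq0 eq_sym; apply/eqP.
apply: (mulfI (lt0r_neq0 (pi_gt0 R))).
rewrite -(bandlimited_inversion_itv s0 bh ab) -RintegralZl//.
by apply: eq_Rintegral => y _; rewrite conv_rep.
Qed.

End SmoothRepresentative.

Section Subsequences.

Lemma cvgn_ge_id (phi : nat -> nat) :
  (forall k, (k <= phi k)%N) -> phi @ \oo --> \oo.
Proof.
move=> phi_ge; apply/cvgnyPge => A; exists A => // k /= Ak.
exact: leq_trans (phi_ge k).
Qed.

Lemma cvg_subsubsequence (T : topologicalType) (u : nat -> T) (l : T) :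
  (forall psi, (forall k, (k <= psi k)%N) ->
    exists2 phi, (forall k, (k <= phi k)%N) &
      u (psi (phi k)) @[k --> \oo] --> l) ->
  u @ \oo --> l.
Proof.
move=> sub U Ul; apply: contrapT => nU.
have /choice[psi psiP] N : exists n, (N <= n)%N /\ ~ U (u n).
  apply: contrapT => nN; apply: nU; exists N => // n /= Nn.
  by apply: contrapT => Un; apply: nN; exists n.
have [phi _ /(_ U Ul)[N _ UN]] := sub psi (fun k => (psiP k).1).
exact: (psiP (phi N)).2 (UN N (leqnn N)).
Qed.

Lemma countable_diagonal_subsequence (T : countType)
    (R : realType) (u : nat -> T -> R) (g : T -> R) (F : set_system nat) :
  ProperFilter F -> \oo `<=` F -> (forall t, u n t @[n --> F] --> g t) ->
  exists2 phi, (forall k, (k <= phi k)%N) &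
    forall t, u (phi k) t @[k --> \oo] --> g t.
Proof.
move=> FF ooF ug.
pose close k n t := `|g t - u n t| < k.+1%:R^-1.
have /choice[phi phiP] k : exists n, (k <= n)%N /\
    forall j : 'I_k.+1, oapp (close k n) true (unpickle j).
  apply: (@filter_ex _ F); apply: filterI; first by apply: ooF;
    exact: nbhs_infty_ge.
  apply: filter_forall => j; case: (unpickle j) => [t|] /=; last exact: filterE.
  by have /cvgrPdist_lt := ug t; apply; rewrite invr_gt0.
exists phi => [k|t]; first by have [] := phiP k.
apply/cvgrPdist_lt => e e0; near=> k.
have tk : (pickle t < k.+1)%N by rewrite ltnS; near: k; exact: nbhs_infty_ge.
have := (phiP k).2 (Ordinal tk); rewrite pickleK => /lt_trans; apply.
by near: k; exact: near_infty_natSinv_lt (PosNum e0).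
Unshelve. all: end_near. Qed.

End Subsequences.

Section LipschitzSubsequence.
Variable R : realType.

Lemma bounded_ultra_cvg (T : Type) (U : set_system T) (f : T -> R) (M : R) :
  UltraFilter U -> (forall x, `|f x| <= M) -> exists p : R, f @ U --> p.
Proof.
move=> UU fM.
have [p [_ pc]] : (`[- M, M]%classic `&` cluster (f @ U)) !=set0.
  apply: (@segment_compact R (- M) M); apply: (@filterE _ U) => x.
  by rewrite /= in_itv /= -ler_norml.
exists p => B pB; have [//|nB] := in_ultra_setVsetC (f @^-1` B) UU.
by have [y [nBy By]] := pc (~` B) B nB pB.
Qed.

Lemma lipschitz_cvg_rat (u : nat -> R -> R) (g : R -> R) (L : R) :
  (forall n x y, `|u n x - u n y| <= L * `|x - y|) ->
  (forall x y, `|g x - g y| <= L * `|x - y|) ->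
  (forall q : rat, u n (ratr q) @[n --> \oo] --> g (ratr q)) ->
  forall x, u n x @[n --> \oo] --> g x.
Proof.
move=> uL gL ug x; apply/cvgrPdist_lt => e e0.
have L0 : 0 <= L.
  by have := le_trans (normr_ge0 _) (gL 1 0); rewrite subr0 normr1 mulr1.
have d0 : 0 < e / 3 / (L + 1) by rewrite !divr_gt0// ltr_wpDl.
have [q] : exists q, ratr q \in `]x, x + e / 3 / (L + 1)[.
  by apply: rat_in_itvoo; rewrite ltrDl.
rewrite in_itv /= => /andP[xq qd].
have Lxq : L * `|x - ratr q| <= e / 3.
  apply: (@le_trans _ _ ((L + 1) * (e / 3 / (L + 1)))).
    by rewrite distrC gtr0_norm ?subr_gt0// ler_pM//; lra.
  by rewrite mulrC mulfVK// gt_eqF// ltr_wpDl.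
near=> n; have ugq : `|g (ratr q) - u n (ratr q)| < e / 3.
  by near: n; move/cvgrPdist_lt: (ug q); apply; rewrite divr_gt0.
have := le_trans (gL x (ratr q)) Lxq; have := le_trans (uL n x (ratr q)) Lxq.
move: ugq; rewrite !ler_norml !ltr_norml.
by move=> /andP[? ?] /andP[? ?] /andP[? ?]; apply/andP; split; lra.
Unshelve. all: end_near. Qed.

Lemma lipschitz_subsequence (I : countType) (u : nat -> I -> R -> R) (M L : R) :
  (forall n i x, `|u n i x| <= M) ->
  (forall n i x y, `|u n i x - u n i y| <= L * `|x - y|) ->
  exists g : I -> R -> R, exists2 phi, (forall k, (k <= phi k)%N) &
    forall i x, u (phi k) i x @[k --> \oo] --> g i x.
Proof.
move=> uM uL; have [U [UU ooU]] := ultraFilterLemma eventually_filter.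
have /choice[g ug] (p : I * R) : exists l : R, u n p.1 p.2 @[n --> U] --> l.
  by apply: bounded_ultra_cvg => n; exact: uM.
have gL i x y : `|g (i, x) - g (i, y)| <= L * `|x - y|.
  apply: (@ler_cvg_to _ U _ _ (fun n => `|u n i x - u n i y|)) (cvg_cst _) _.
    by apply: cvg_norm; apply: cvgB; [exact: (ug (i, x))|exact: (ug (i, y))].
  by apply: filterE => n; exact: uL.
have [phi phi_ge cv] := countable_diagonal_subsequence (T := (I * rat)%type)
  (u := fun n p => u n p.1 (ratr p.2)) (g := fun p => g (p.1, ratr p.2))
  ultra_proper ooU
  (fun p => ug (p.1, ratr p.2)).
exists (fun i x => g (i, x)), phi => // i.
apply: lipschitz_cvg_rat (fun n => uL (phi n) i) (gL i) _ => q.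
exact: cv (i, q).
Qed.

End LipschitzSubsequence.

Section VanishingAtInfinity.
Variable R : realType.
Local Notation leb := (@lebesgue_measure R).

Definition vanishes_at_infinity (v : R -> R) : Prop :=
  forall e, 0 < e -> exists X : R, forall x, X < `|x| -> `|v x| < e.

Lemma vanishes_at_infinity_bounded v : continuous v ->
  vanishes_at_infinity v -> exists M : R, forall x, `|v x| <= M.
Proof.
move=> cv v0; have [X vX] := v0 1 ltr01.
have [||c _ cmax] := @EVT_max R (fun x => `|v x|) (- `|X|) `|X|.
- by apply: le_trans (normr_ge0 X); rewrite oppr_le0.
- by apply: continuous_subspaceT => x; apply: cvg_norm; exact: cv.
exists (1 + `|v c|) => x; have [xX|xX] := leP `|x| `|X|.
  by apply: le_trans (cmax x _) _; rewrite ?in_itv /= -?ler_norml// lerDr.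
apply: le_trans (ltW (vX x _)) _; last by rewrite lerDl.
exact: le_lt_trans (ler_norm X) xX.
Qed.

Lemma vanishes_at_infinity_approx (v : R -> R) (M e : R) :
  measurable_fun setT v ->
  (forall x, `|v x| <= M) -> vanishes_at_infinity v -> 0 < e ->
  exists2 w, Rintegrable leb w & forall x, `|v x - w x| <= e.
Proof.
move=> mv vM v0 e0; have [X vX] := v0 _ e0.
exists (fun x => \1_`[- X, X] x * v x).
  exact: (Rintegrable_mul_bounded (integrable_indic_itv _ _ _ _) mv vM).
move=> x; rewrite indicE; have [xX|] := boolP (x \in _).
  by rewrite mul1r subrr normr0 ltW.
rewrite mul0r subr0 mem_setE in_itv /= -ler_norml -ltNge.
by move=> /vX /ltW.
Qed.

(* Replace v by an integrable w with |v - w| <= e: dominated convergence handles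
   w, the L^1 bound handles v - w. *)
Lemma cvg_Rintegral_mul_vanishing (d : nat -> R -> R) (v : R -> R) (A B M : R) :
  (forall n, Rintegrable leb (d n)) -> (forall n x, `|d n x| <= A) ->
  (forall n, \int[leb]_x `|d n x| <= B) ->
  (forall x, d ^~ x @ \oo --> (0 : R)) ->
  measurable_fun setT v -> (forall x, `|v x| <= M) -> vanishes_at_infinity v ->
  \int[leb]_x (d n x * v x) @[n --> \oo] --> (0 : R).
Proof.
move=> di dA dB d0 mv vM v0.
have B1 : 0 < B + 1 by rewrite ltr_wpDl// (le_trans _ (dB 0))// Rintegral_ge0.
apply/cvgrPdist_le => e e0; have e2 : 0 < e / 2 by rewrite divr_gt0.
have [w iw vw] := vanishes_at_infinity_approx mv vM v0 (divr_gt0 e2 B1).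
have md n := Rintegrable_measurable (di n).
have wcvg := cvg_Rintegral_mul_bounded md dA d0 iw.
have mvw : measurable_fun setT (fun x => v x - w x).
  by apply: measurable_funB => //; exact: Rintegrable_measurable iw.
near=> n; rewrite sub0r normrN.
have -> : \int[leb]_x (d n x * v x) =
    \int[leb]_x (w x * d n x) + \int[leb]_x (d n x * (v x - w x)).
  rewrite -RintegralD//; first by apply: eq_Rintegral => x _; ring.
    exact: (Rintegrable_mul_bounded iw (md n) (dA n)).
  exact: (Rintegrable_mul_bounded (di n) mvw vw).
apply: le_trans (ler_normD _ _) _; rewrite [e in _ <= e]splitr; apply: lerD.
  by rewrite -normrN -sub0r; near: n; move/cvgrPdist_le : wcvg; exact.
apply: le_trans (ler_norm_Rintegral_mul_bounded (di n) mvw vw) _.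
rewrite mulrAC ler_pdivrMr// ler_wpM2l ?(ltW e2)//.
by apply: le_trans (dB n) _; rewrite lerDl.
Unshelve. all: end_near. Qed.

End VanishingAtInfinity.

Section FrequencyWindow.
Variable R : realType.
Local Notation leb := (@lebesgue_measure R).
Variables (t c : R).

(* Averaging cos (u r + c) over the frequencies r in [t, t + d] gives a function
   of u that vanishes at infinity, against which a weak limit can be tested. *)
Definition freq_window (d : R) : R -> R := cosint `[t, t + d] (fun=> 1) c.

Section Window.
Variable d : R.
Hypothesis d0 : 0 < d.

Let td : t <= t + d. Proof. by rewrite lerDl ltW. Qed.

Let mtd : measurable (`[t, t + d]%classic : set R).
Proof. exact: measurable_itv. Qed.

Let leb_td := lebesgue_measure_itvcc_lty t (t + d).

Let norm1 r : `[t, t + d]%classic r -> `|1 : R| <= 1.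
Proof. by rewrite normr1. Qed.

Let norm_le r : `[t, t + d]%classic r -> `|r| <= `|t| + d.
Proof.
rewrite /= in_itv /= => /andP[tr rtd]; rewrite -[r](subrK t) addrC.
by apply: le_trans (ler_normD _ _) _; rewrite lerD2l ger0_norm ?subr_ge0//; lra.
Qed.

Lemma ler_norm_freq_window u : `|freq_window d u| <= d.
Proof.
apply: le_trans (ler_norm_cosint mtd leb_td (measurable_cst _) norm1 c u) _.
by rewrite fine_lebesgue_measure_itvcc// mul1r addrC addKr.
Qed.

Lemma measurable_freq_window : measurable_fun setT (freq_window d).
Proof.
exact: (measurable_cosint mtd leb_td (measurable_cst _) norm1 norm_le).
Qed.

Lemma freq_window_vanishes : vanishes_at_infinity (freq_window d).
Proof.
move=> e e0; exists (2 / e) => u eu.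
have u0 : 0 < `|u| by apply: lt_trans eu; rewrite divr_gt0.
have un0 : u != 0 by rewrite -normr_gt0.
have dF (r : R) : is_derive r 1 (fun r => u^-1 * sin (u * r + c))
  (1 * cos (u * r + c)).
  by apply: is_derive_eq; rewrite /GRing.scale /=; field.
have cF : continuous (fun r => 1 * cos (u * r + c)).
  have dcos (r : R) : is_derive r 1 (fun r => 1 * cos (u * r + c))
    (- u * sin (u * r + c)).
    by apply: is_derive_eq; rewrite /GRing.scale /=; ring.
  exact: is_derive_continuous dcos.
rewrite /freq_window /cosint (Rintegral_FTC td dF cF) -mulrBr normrM normfV.
apply: (@le_lt_trans _ _ (`|u|^-1 * 2));
  last by rewrite mulrC ltr_pdivrMr// -ltr_pdivrMl// mulrC.
rewrite ler_wpM2l ?invr_ge0// (_ : 2 = 1 + 1)//.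
by apply: le_trans (ler_normB _ _) (lerD _ _); exact: sin_max.
Qed.

Lemma freq_window_dist u :
  `|freq_window d u - d * cos (u * t + c)| <= `|u| * d * d.
Proof.
have -> : d * cos (u * t + c) = \int[leb]_(r in `[t, t + d]) cos (u * t + c).
  by rewrite Rintegral_cst// fine_lebesgue_measure_itvcc//; ring.
have icos := integrable_cosint mtd leb_td (measurable_cst _) norm1 c u.
rewrite /freq_window /cosint -RintegralB//; last first.
  by apply: (@itv_bounded_integrable _ _ _ _ 1) => // r _; exact: cos_max.
have tdE : d = t + d - t by ring.
rewrite [X in _ <= _ * X]tdE; apply: ler_norm_Rintegral_itv => // [|r].
  apply: measurable_funTS; apply: measurable_funB => //.
  by apply: measurable_funM => //; exact: measurable_cos_affine.
rewrite in_itv /= => /andP[tr rtd]; rewrite mul1r.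
have dcos (v : R) : is_derive v 1 (fun v => cos (u * v + c))
  (- u * sin (u * v + c)).
  by apply: is_derive_eq; rewrite /GRing.scale /=; ring.
apply: le_trans (is_derive_lipschitz dcos (K := `|u|) _ r t) _.
  by move=> v; rewrite normrM normrN ler_piMr// sin_max.
by rewrite ler_wpM2l// ger0_norm ?subr_ge0//; lra.
Qed.

Lemma bandlimited_conv_freq_window_eq0 s h y : bandlimited s h -> s < t ->
  conv h (freq_window d) y = 0.
Proof.
move=> bh st.
apply: (bandlimited_conv_cosint_eq0 c y bh mtd leb_td _ norm1) => // r.
by rewrite /= in_itv /= => /andP[tr _]; exact: lt_le_trans tr.
Qed.

End Window.

Lemma cvg_freq_window_mean u :
  n.+1%:R * freq_window n.+1%:R^-1 u @[n --> \oo] --> cos (u * t + c).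
Proof.
apply: (@cvg_harmonic_dist _ _ _ `|u|) => n.
have n0 : 0 < n.+1%:R^-1 :> R by rewrite invr_gt0.
have -> : n.+1%:R * freq_window n.+1%:R^-1 u - cos (u * t + c) =
    n.+1%:R * (freq_window n.+1%:R^-1 u - n.+1%:R^-1 * cos (u * t + c)).
  by rewrite mulrBr mulrA mulfV// mul1r.
rewrite normrM [`|n.+1%:R|]ger0_norm// -ler_pdivlMl// [leRHS]mulrC.
exact: freq_window_dist.
Qed.

End FrequencyWindow.

Section BandlimitedLimits.
Variable R : realType.
Local Notation leb := (@lebesgue_measure R).

Lemma ae_eq_bandlimited (s : R) (h g : R -> R) : bandlimited s h ->
  measurable_fun setT g -> {ae leb, forall x, h x = g x} -> bandlimited s g.
Proof.
move=> [ih h0] mg hg; have ig := ae_eq_Rintegrable ih mg hg.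
split=> // c t st; rewrite -(h0 c t st); apply: ae_eq_Rintegral;
  [exact: Rintegrable_mul_cos|exact: Rintegrable_mul_cos|].
by apply: filterS hg => x ->.
Qed.

Lemma cvg_conv_vanishing (h : nat -> R -> R) (g k : R -> R) (A B K : R) :
  (forall n, Rintegrable leb (h n)) -> (forall n x, `|h n x| <= A) ->
  (forall n, \int[leb]_x `|h n x| <= B) -> Rintegrable leb g ->
  (forall x, h ^~ x @ \oo --> g x) ->
  measurable_fun setT k -> (forall u, `|k u| <= K) -> vanishes_at_infinity k ->
  conv (h n) k 0 @[n --> \oo] --> conv g k 0.
Proof.
move=> ih hA hB ig hg mk kK k0.
have gA x : `|g x| <= A.
  by apply: (ler_cvg_to (cvg_norm (hg x)) (cvg_cst A)); exact: nearW.
have ihg n := RintegrableB (ih n) ig.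
have hgA n x : `|h n x - g x| <= A + A.
  by apply: le_trans (ler_normB _ _) (lerD _ _).
have hgB n : \int[leb]_x `|h n x - g x| <= B + \int[leb]_x `|g x|.
  have [inh ing] := (Rintegrable_norm (ih n), Rintegrable_norm ig).
  apply: le_trans (lerD (hB n) (lexx _)); rewrite -RintegralD//.
  apply: le_Rintegral => //; [exact: Rintegrable_norm|exact: RintegrableD|].
  by move=> x _; exact: ler_normB.
have hg0 x : h n x - g x @[n --> \oo] --> (0 : R).
  exact/subr_cvg0/hg.
have kr0 : vanishes_at_infinity (fun x => k (0 - x)).
  by move=> e /k0[X kX]; exists X => x Xx; apply: kX; rewrite sub0r normrN.
apply/subr_cvg0.
have conv_sub : (fun n => conv (h n) k 0 - conv g k 0) =
    fun n => \int[leb]_x ((h n x - g x) * k (0 - x)).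
  apply/funext => n; rewrite /conv -RintegralB//; first last.
  - exact: Rintegrable_conv ig mk kK.
  - exact: Rintegrable_conv (ih n) mk kK.
  by apply: eq_Rintegral => x _; rewrite mulrBl.
rewrite conv_sub; exact: cvg_Rintegral_mul_vanishing ihg hgA hgB hg0
  (measurable_translate_reflect 0 mk) (fun x => kK (0 - x)) kr0.
Qed.

Lemma cvg_conv_freq_window (g : R -> R) (t c : R) : Rintegrable leb g ->
  n.+1%:R * conv g (freq_window t c n.+1%:R^-1) 0 @[n --> \oo] -->
  cos_transform g c t.
Proof.
move=> ig; have n0 n : 0 < n.+1%:R^-1 :> R by rewrite invr_gt0.
have conv_mean n : n.+1%:R * conv g (freq_window t c n.+1%:R^-1) 0 =
    \int[leb]_x (g x * (n.+1%:R * freq_window t c n.+1%:R^-1 (0 - x))).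
  rewrite -RintegralZl//; first by apply: eq_Rintegral => x _; rewrite mulrCA.
  apply: Rintegrable_conv ig (measurable_freq_window t c _) _.
  exact: ler_norm_freq_window.
under eq_fun do rewrite conv_mean.
apply: (@Rintegral_dominated_cvg _ _ _ leb _ _ (fun x => `|g x|)).
- move=> n; apply: measurable_funM; first exact: Rintegrable_measurable ig.
  apply: measurable_funM => //; apply: measurable_translate_reflect.
  exact: measurable_freq_window.
- apply: measurable_funM; first exact: Rintegrable_measurable ig.
  exact: measurable_cosB.
- apply: aeW => x; apply: cvgM; first exact: cvg_cst.
  have -> : c - x * t = (0 - x) * t + c by ring.
  exact: cvg_freq_window_mean.
- exact: Rintegrable_norm.
- move=> n x; rewrite normrM ler_piMr// normrM ger0_norm// -ler_pdivlMl// mulr1.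
  exact: ler_norm_freq_window.
Qed.

Lemma bandlimited_cvg (s A B : R) (h : nat -> R -> R) (g : R -> R) :
  (forall n, bandlimited s (h n)) -> (forall n x, `|h n x| <= A) ->
  (forall n, \int[leb]_x `|h n x| <= B) -> Rintegrable leb g ->
  (forall x, h ^~ x @ \oo --> g x) -> bandlimited s g.
Proof.
move=> bh hA hB ig hg; split=> // c t st.
have window0 d : 0 < d -> conv g (freq_window t c d) 0 = 0.
  move=> d0; have := cvg_conv_vanishing (fun n => (bh n).1) hA hB ig hg
    (measurable_freq_window t c d) (ler_norm_freq_window t c d0)
    (freq_window_vanishes t c d0).
  under eq_fun do rewrite (bandlimited_conv_freq_window_eq0 c d 0 (bh _) st).
  by move=> /cvg_lim <-//; rewrite lim_cst.
have := @cvg_conv_freq_window g t c ig.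
under eq_fun do rewrite window0 ?invr_gt0// mulr0.
by move=> /cvg_lim <-//; rewrite lim_cst.
Qed.

End BandlimitedLimits.

Section ComplexNumbers.
Variable R : realType.
Implicit Types (z w : R[i]).
Local Open Scope complex_scope.

Lemma cReD z w : cRe (z + w) = cRe z + cRe w.
Proof. by case: z w => ? ? []. Qed.

Lemma cImD z w : cIm (z + w) = cIm z + cIm w.
Proof. by case: z w => ? ? []. Qed.

Lemma cReN z : cRe (- z) = - cRe z. Proof. by case: z. Qed.

Lemma cImN z : cIm (- z) = - cIm z. Proof. by case: z. Qed.

Lemma cReM z w : cRe (z * w) = cRe z * cRe w - cIm z * cIm w.
Proof. by case: z w => ? ? []. Qed.

Lemma cImM z w : cIm (z * w) = cRe z * cIm w + cIm z * cRe w.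
Proof. by case: z w => ? ? []. Qed.

Lemma complex_ext z w : cRe z = cRe w -> cIm z = cIm w -> z = w.
Proof. by case: z w => ? ? [? ?] /= -> ->. Qed.

Lemma normc_cnorm z : `|z| = (cnorm z)%:C.
Proof. exact: normc_def. Qed.

Lemma cnorm_ge0 z : 0 <= cnorm z. Proof. exact: sqrtr_ge0. Qed.

Lemma cnorm_real (k : R) : cnorm k%:C = `|k|.
Proof. by rewrite /cnorm /= expr0n /= addr0 sqrtr_sqr. Qed.

Lemma cnorm_real_ge0 (k : R) : 0 <= k -> cnorm k%:C = k.
Proof. by move=> k0; rewrite cnorm_real ger0_norm. Qed.

Lemma cnorm0 : cnorm (0 : R[i]) = 0. Proof. by rewrite cnorm_real normr0. Qed.

Lemma cnorm1 : cnorm (1 : R[i]) = 1. Proof. by rewrite cnorm_real normr1. Qed.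

Lemma cnorm_eq0 z : cnorm z = 0 -> z = 0.
Proof. by move=> z0; apply/normr0_eq0; rewrite normc_cnorm z0. Qed.

Lemma cnormM z w : cnorm (z * w) = cnorm z * cnorm w.
Proof. by apply: complexI; rewrite rmorphM /= -!normc_cnorm normrM. Qed.

Lemma cnormMn z n : cnorm (z *+ n) = cnorm z *+ n.
Proof. by apply: complexI; rewrite rmorphMn /= -!normc_cnorm normrMn. Qed.

Lemma cnormN z : cnorm (- z) = cnorm z.
Proof. by apply: complexI; rewrite -!normc_cnorm normrN. Qed.

Lemma cnormD z w : cnorm (z + w) <= cnorm z + cnorm w.
Proof. by rewrite -lecR rmorphD /= -!normc_cnorm ler_normD. Qed.

Lemma cnormB z w : cnorm (z - w) <= cnorm z + cnorm w.
Proof. by rewrite -(cnormN w) cnormD. Qed.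

Lemma cnorm_distC z w : cnorm (z - w) = cnorm (w - z).
Proof. by rewrite -cnormN opprB. Qed.

Lemma ler_dist_cnorm z w : `|cnorm z - cnorm w| <= cnorm (z - w).
Proof.
have := cnormD (z - w) w; have := cnormD (w - z) z.
rewrite !subrK (cnorm_distC w z) => wz zw.
by rewrite ler_norml; apply/andP; split; lra.
Qed.

Lemma sqr_cnorm z : cnorm z ^+ 2 = cRe z ^+ 2 + cIm z ^+ 2.
Proof. by rewrite sqr_sqrtr// addr_ge0 ?sqr_ge0. Qed.

Lemma cnorm_conjc z : cnorm (conjc z) = cnorm z.
Proof. by case: z => ? ?; rewrite /cnorm /= sqrrN. Qed.

Lemma cRe_conjcM z : cRe (conjc z * z) = cnorm z ^+ 2.
Proof.
by rewrite sqr_cnorm cReM; case: z => ? ?; rewrite /cRe /cIm /=; ring.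
Qed.

Definition cpart (b : bool) z : R := if b then cRe z else cIm z.

Lemma cpart0 b : cpart b 0 = 0. Proof. by case: b. Qed.

Lemma cpartB b z w : cpart b (z - w) = cpart b z - cpart b w.
Proof. by case: b; rewrite /= ?(cReD, cReN, cImD, cImN). Qed.

Lemma eq_cpart z w : (forall b, cpart b z = cpart b w) -> z = w.
Proof. by move=> zw; apply: complex_ext; [exact: zw true|exact: zw false]. Qed.

Lemma ler_norm_cpart b z : `|cpart b z| <= cnorm z.
Proof.
by rewrite -sqrtr_sqr ler_wsqrtr//; case: b; rewrite ?lerDl ?lerDr sqr_ge0.
Qed.

Lemma ler_cnorm z : cnorm z <= `|cRe z| + `|cIm z|.
Proof.
rewrite -ler_sqr ?nnegrE ?cnorm_ge0 ?addr_ge0// sqr_cnorm sqrrD.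
by rewrite !real_normK ?num_real// lerD2r lerDl mulrn_wge0// mulr_ge0.
Qed.

Definition complex_cvg (z_ : nat -> R[i]) z : Prop :=
  cnorm (z_ n - z) @[n --> \oo] --> (0 : R).

Lemma complex_cvgP (z_ : nat -> R[i]) z : complex_cvg z_ z <->
  forall b, cpart b (z_ n) @[n --> \oo] --> cpart b z.
Proof.
split=> [zz b|zz].
  apply/subr_cvg0/norm_cvg0P; apply: squeeze_cvgr (cvg_cst 0) zz.
  by apply: nearW => n; rewrite normr_ge0 -cpartB ler_norm_cpart.
have sum_cvg0 : `|cpart true (z_ n) - cpart true z| +
    `|cpart false (z_ n) - cpart false z| @[n --> \oo] --> (0 : R).
  by rewrite -(addr0 (0 : R)); apply: cvgD; apply/norm_cvg0P/subr_cvg0.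
apply: squeeze_cvgr (cvg_cst 0) sum_cvg0.
by apply: nearW => n; rewrite cnorm_ge0 -!cpartB ler_cnorm.
Qed.

Lemma complex_cvg_cnorm (z_ : nat -> R[i]) z :
  complex_cvg z_ z -> cnorm (z_ n) @[n --> \oo] --> cnorm z.
Proof.
move=> zz; apply/subr_cvg0/norm_cvg0P; apply: squeeze_cvgr (cvg_cst 0) zz.
by apply: nearW => n; rewrite normr_ge0 ler_dist_cnorm.
Qed.

Lemma complex_cvg_unique (z_ : nat -> R[i]) z w :
  complex_cvg z_ z -> complex_cvg z_ w -> z = w.
Proof.
move=> /complex_cvgP zz /complex_cvgP zw.
by apply: eq_cpart => b; exact: cvg_unique (zz b) (zw b).
Qed.

End ComplexNumbers.

Section ComplexIntegrals.
Variable R : realType.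
Local Notation leb := (@lebesgue_measure R).
Local Notation F := (R -> R[i]).
Implicit Types (f g u : F) (a : R[i]).

Lemma cintegrableP f :
  cintegrable f <-> forall b, Rintegrable leb (fun x => cpart b (f x)).
Proof.
by split=> [[ir ii] []//|fi]; split; [exact: fi true|exact: fi false].
Qed.

Lemma measurable_cnorm f :
  (forall b, measurable_fun setT (fun x => cpart b (f x))) ->
  measurable_fun setT (fun x => cnorm (f x)).
Proof.
move=> mf.
apply: (measurableT_comp (continuous_measurable_fun (@sqrt_continuous R))).
by apply: measurable_funD; apply: measurable_funX;
  [exact: mf true|exact: mf false].
Qed.

Lemma cintegrable_cnorm f : cintegrable f ->
  Rintegrable leb (fun x => cnorm (f x)).
Proof.
move=> /cintegrableP fi.
apply: (@le_Rintegrable _ _ _ leb _ (fun x => `|cRe (f x)| + `|cIm (f x)|)).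
- by apply: measurable_cnorm => b; exact: Rintegrable_measurable (fi b).
- by move=> x; rewrite ger0_norm ?cnorm_ge0 ?ler_cnorm.
- by apply: RintegrableD; apply: Rintegrable_norm;
    [exact: fi true|exact: fi false].
Qed.

Lemma le_cintegrable f (g : R -> R) :
  (forall b, measurable_fun setT (fun x => cpart b (f x))) ->
  (forall x, cnorm (f x) <= g x) -> Rintegrable leb g -> cintegrable f.
Proof.
move=> mf fg ig; apply/cintegrableP => b.
apply: (@le_Rintegrable _ _ _ leb _ g) => [|x|//]; first exact: mf.
exact: le_trans (ler_norm_cpart b _) (fg x).
Qed.

Lemma cintegrable0 : cintegrable (fun=> 0 : R[i]).
Proof. by split; exact: Rintegrable0. Qed.

Lemma cintegrable_lin a f g : cintegrable f -> cintegrable g ->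
  cintegrable (fun x => a * f x + g x).
Proof.
move=> [fr fi] [gr gi]; split.
- under eq_fun do rewrite cReD cReM.
  by apply: RintegrableD => //; apply: RintegrableB; exact: RintegrableZl.
- under eq_fun do rewrite cImD cImM.
  by apply: RintegrableD => //; apply: RintegrableD; exact: RintegrableZl.
Qed.

Lemma cintegrableD f g : cintegrable f -> cintegrable g ->
  cintegrable (fun x => f x + g x).
Proof.
move=> fi gi; have := cintegrable_lin 1 fi gi.
by congr cintegrable; apply/funext => x; rewrite mul1r.
Qed.

Lemma cintegrableB f g : cintegrable f -> cintegrable g ->
  cintegrable (fun x => f x - g x).
Proof.
move=> fi gi; have := cintegrable_lin (-1) gi fi.
by congr cintegrable; apply/funext => x; rewrite mulN1r addrC.
Qed.

Lemma cintegrable_mul_bounded f u (C : R) : cintegrable f ->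
  (forall b, measurable_fun setT (fun x => cpart b (u x))) ->
  (forall x, cnorm (u x) <= C) -> cintegrable (fun x => f x * u x).
Proof.
move=> fi mu uC; have mf b := Rintegrable_measurable ((cintegrableP f).1 fi b).
apply: (@le_cintegrable _ (fun x => C * cnorm (f x))) => [[]|x|] /=.
- under eq_fun do rewrite cReM; apply: measurable_funB; apply: measurable_funM;
    [exact: mf true|exact: mu true|exact: mf false|exact: mu false].
- under eq_fun do rewrite cImM; apply: measurable_funD; apply: measurable_funM;
    [exact: mf true|exact: mu false|exact: mf false|exact: mu true].
- by rewrite cnormM mulrC ler_wpM2r ?cnorm_ge0.
- exact/RintegrableZl/cintegrable_cnorm.
Qed.

Lemma cint_lin a f g : cintegrable f -> cintegrable g ->
  cint (fun x => a * f x + g x) = a * cint f + cint g.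
Proof.
move=> [fr fi] [gr gi].
have iZ k (h : R -> R) : Rintegrable leb h ->
  Rintegrable leb (fun x => k * h x).
  exact: RintegrableZl.
have [rfr ifr] := (iZ (cRe a) _ fr, iZ (cIm a) _ fr).
have [rfi ifi] := (iZ (cRe a) _ fi, iZ (cIm a) _ fi).
apply: complex_ext; rewrite (cReD, cImD) (cReM, cImM) /=.
- rewrite -!RintegralZl// -RintegralB// -RintegralD//; last exact: RintegrableB.
  by apply: eq_Rintegral => x _; rewrite cReD cReM.
- rewrite -!RintegralZl// -!RintegralD//; last exact: RintegrableD.
  by apply: eq_Rintegral => x _; rewrite cImD cImM.
Qed.

Lemma cint0 : cint (fun=> 0 : R[i]) = 0.
Proof. by rewrite /cint /= Rintegral_eq0. Qed.

Lemma cintZ a f : cintegrable f -> cint (fun x => a * f x) = a * cint f.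
Proof.
move=> fi; have := cint_lin a fi cintegrable0; rewrite cint0 addr0 => <-.
by congr cint; apply/funext => x; rewrite addr0.
Qed.

(* |z|^2 = Re (z^* z) for z = cint f, and z^* z is the integral of z^* f. *)
Lemma cnorm_cint_le f : cintegrable f -> cnorm (cint f) <= L1norm f.
Proof.
move=> fi; set z := cint f; have [->|z0] := eqVneq (cnorm z) 0.
  by apply: Rintegral_ge0 => x _; exact: cnorm_ge0.
have zgt0 : 0 < cnorm z by rewrite lt_neqAle eq_sym z0 cnorm_ge0.
have zfi : cintegrable (fun x => conjc z * f x).
  have := cintegrable_lin (conjc z) fi cintegrable0.
  by congr cintegrable; apply/funext => x; rewrite addr0.
rewrite -(ler_pM2l zgt0) -[X in X <= _]expr2 -cRe_conjcM -cintZ//.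
rewrite -[X in _ <= X * _]cnorm_conjc -RintegralZl//;
  last exact: cintegrable_cnorm.
apply: le_Rintegral => //; first by case: zfi.
  exact/RintegrableZl/cintegrable_cnorm.
by move=> x _; rewrite -cnormM;
  apply: le_trans (ler_norm _) (ler_norm_cpart true _).
Qed.

Lemma L1norm_ge0 f : 0 <= L1norm f.
Proof. by apply: Rintegral_ge0 => x _; exact: cnorm_ge0. Qed.

Lemma L1norm0 : L1norm (fun=> 0 : R[i]) = 0.
Proof. by apply: Rintegral_eq0 => x _; rewrite cnorm0. Qed.

Lemma L1normZ a f : cintegrable f ->
  L1norm (fun x => a * f x) = cnorm a * L1norm f.
Proof.
move=> fi; rewrite /L1norm -RintegralZl//; last exact: cintegrable_cnorm.
by apply: eq_Rintegral => x _; rewrite cnormM.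
Qed.

Lemma L1normB_le f g : cintegrable f -> cintegrable g ->
  L1norm (fun x => f x - g x) <= L1norm f + L1norm g.
Proof.
move=> fi gi; have [nf ng] := (cintegrable_cnorm fi, cintegrable_cnorm gi).
rewrite /L1norm -RintegralD//; apply: le_Rintegral => //.
- exact/cintegrable_cnorm/cintegrableB.
- exact: RintegrableD.
- by move=> x _; exact: cnormB.
Qed.

Lemma L1norm_ae_eq f g : cintegrable f -> cintegrable g -> L1eq f g ->
  L1norm f = L1norm g.
Proof.
move=> fi gi fg.
apply: ae_eq_Rintegral; [exact: cintegrable_cnorm|exact: cintegrable_cnorm|].
by apply: filterS fg => x ->.
Qed.

Lemma Rintegral_norm_cpart_le b f : cintegrable f ->
  \int[leb]_x `|cpart b (f x)| <= L1norm f.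
Proof.
move=> fi; apply: le_Rintegral => //; last by move=> x _; exact: ler_norm_cpart.
  exact: Rintegrable_norm ((cintegrableP f).1 fi b).
exact: cintegrable_cnorm.
Qed.

(* Dominated convergence for |G_n| - |G_n - g|, which is bounded by |g|. *)
Lemma L1norm_scheffe (G : nat -> F) g :
  (forall n, cintegrable (G n)) -> cintegrable g ->
  (forall n, L1norm (G n) <= L1norm g) ->
  (forall x, complex_cvg (G ^~ x) (g x)) ->
  L1norm (fun x => G n x - g x) @[n --> \oo] --> (0 : R).
Proof.
move=> iG ig Gg Gcvg.
have inG n := cintegrable_cnorm (iG n); have ing := cintegrable_cnorm ig.
have inD n := cintegrable_cnorm (cintegrableB (iG n) ig).
have diff_cvg : L1norm (G n) - L1norm (fun x => G n x - g x) @[n --> \oo] -->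
  L1norm g.
  have -> : (fun n => L1norm (G n) - L1norm (fun x => G n x - g x)) =
      fun n => \int[leb]_x (cnorm (G n x) - cnorm (G n x - g x)).
    by apply/funext => n; rewrite -RintegralB//; [exact: inG|exact: inD].
  apply: (@Rintegral_dominated_cvg _ _ _ leb _ _ (fun x => cnorm (g x))) => //.
  - by move=> n; exact: Rintegrable_measurable (RintegrableB (inG n) (inD n)).
  - exact: (Rintegrable_measurable ing).
  - apply: aeW => x; rewrite -[X in _ --> X]subr0.
    by apply: cvgB; [exact: complex_cvg_cnorm|exact: Gcvg].
  - move=> n x; apply: le_trans (ler_dist_cnorm _ _) _.
    by rewrite opprB addrC subrK.
apply/cvgrPdist_le => e e0; near=> n;
  rewrite sub0r normrN ger0_norm ?L1norm_ge0//.
have : `|L1norm g - (L1norm (G n) - L1norm (fun x => G n x - g x))| <= e.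
  by near: n; move/cvgrPdist_le : diff_cvg; exact.
by rewrite ler_norml => /andP[_]; have := Gg n; lra.
Unshelve. all: end_near. Qed.

End ComplexIntegrals.

Section BernsteinSpace.
Variable R : realType.
Local Notation leb := (@lebesgue_measure R).
Local Notation F := (R -> R[i]).
Implicit Types (f g : F) (h : R -> R) (s t c : R).

Lemma cosNpihalfB (a : R) : cos (- (pi / 2) - a) = - sin a.
Proof. by rewrite -cosN opprB opprK cosDpihalf. Qed.

Lemma cos_transformN h c t : cos_transform h c (- t) = cos_transform h (- c) t.
Proof.
by apply: eq_Rintegral => x _; rewrite -cosN; congr (_ * cos _); ring.
Qed.

Lemma cos_transform_phase h c t : Rintegrable leb h ->
  cos_transform h c t =
  cos c * cos_transform h 0 t - sin c * cos_transform h (- (pi / 2)) t.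
Proof.
move=> ih; have ic a := Rintegrable_mul_cos a t ih.
rewrite /cos_transform -!RintegralZl//; [|exact: ic|exact: ic].
rewrite -RintegralB//; [|exact: RintegrableZl|exact: RintegrableZl].
apply: eq_Rintegral => x _.
by rewrite cosNpihalfB cosB sub0r cosN; ring.
Qed.

Lemma bandlimitedP s h : Rintegrable leb h -> bandlimited s h <->
  forall t, s < t ->
    cos_transform h 0 t = 0 /\ cos_transform h (- (pi / 2)) t = 0.
Proof.
move=> ih; split=> [[_ h0] t st|h0]; first by rewrite !h0.
split=> // c t st; have [e0 e1] := h0 t st.
by rewrite cos_transform_phase// e0 e1 !mulr0 subrr.
Qed.

Lemma bandlimited_cos_transform_eq0 s h c t : bandlimited s h -> s < `|t| ->
  cos_transform h c t = 0.
Proof.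
move=> [_ h0]; have [t0|t0] := ger0P t; first exact: h0.
by rewrite -[t in cos_transform _ _ t]opprK cos_transformN; exact: h0.
Qed.

Lemma cnorm_expi t : cnorm (expi t) = 1.
Proof. by rewrite /cnorm /expi /= cos2Dsin2 sqrtr1. Qed.

Lemma cintegrable_mul_expi f t : cintegrable f ->
  cintegrable (fun x => f x * expi (- (x * t))).
Proof.
have cosE x : cos (- (x * t)) = cos (0 - x * t) by rewrite sub0r.
have sinE x : sin (- (x * t)) = cos (- (pi / 2) - x * t).
  by rewrite cosNpihalfB sinN.
move=> fi; apply: (cintegrable_mul_bounded (C := 1) fi) => [[]|x] /=.
- by under eq_fun do rewrite /cRe /= cosE; exact: measurable_cosB.
- by under eq_fun do rewrite /cIm /= sinE; exact: measurable_cosB.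
- by rewrite cnorm_expi.
Qed.

Lemma fourier_lin (a : R[i]) f g t : cintegrable f -> cintegrable g ->
  fourier (fun x => a * f x + g x) t = a * fourier f t + fourier g t.
Proof.
move=> fi gi.
rewrite -(cint_lin a (cintegrable_mul_expi t fi) (cintegrable_mul_expi t gi)).
by congr cint; apply/funext => x; rewrite mulrDl mulrA.
Qed.

Lemma fourierE f t : cintegrable f -> fourier f t =
  Complex (cos_transform (fun x => cRe (f x)) 0 t -
           cos_transform (fun x => cIm (f x)) (- (pi / 2)) t)
          (cos_transform (fun x => cRe (f x)) (- (pi / 2)) t +
           cos_transform (fun x => cIm (f x)) 0 t).
Proof.
move=> [fr fi]; have icos h c := @Rintegrable_mul_cos R h c t.
rewrite /fourier /cint /cos_transform; congr Complex.
- rewrite -RintegralB//; [|exact: icos|exact: icos].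
  by apply: eq_Rintegral => x _;
    rewrite cReM /expi /cRe /cIm /= sinN cosNpihalfB sub0r.
- rewrite -RintegralD//; [|exact: icos|exact: icos].
  by apply: eq_Rintegral => x _;
    rewrite cImM /expi /cRe /cIm /= sinN cosNpihalfB sub0r.
Qed.

Lemma inBP s f : 0 <= s ->
  inB s f <-> forall b, bandlimited s (fun x => cpart b (f x)).
Proof.
move=> s0; split=> [[fi f0] b|fb]; last first.
  have fi : cintegrable f by apply/cintegrableP => b; exact: (fb b).1.
  split=> // t st; rewrite fourierE//.
  rewrite !(bandlimited_cos_transform_eq0 _ (fb true) st).
  by rewrite !(bandlimited_cos_transform_eq0 _ (fb false) st) subrr addr0.
have half_phase h t : Rintegrable leb h ->
    cos_transform h (- (pi / 2)) (- t) = - cos_transform h (- (pi / 2)) t.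
  move=> ih; rewrite cos_transformN opprK (cos_transform_phase (pi / 2))//.
  by rewrite cos_pihalf sin_pihalf mul0r mul1r sub0r.
apply/bandlimitedP; first exact: (cintegrableP f).1 fi b.
move=> t st; have t0 : 0 < t by exact: le_lt_trans st.
have := f0 t; have := f0 (- t); rewrite normrN gtr0_norm// => /(_ st) + /(_ st).
have [fr fm] := fi; rewrite !fourierE// !half_phase//.
rewrite ![cos_transform _ 0 (- t)]cos_transformN oppr0.
by move=> -[e1 e2] [e3 e4]; case: b => /=; split; lra.
Qed.

Lemma inB_cintegrable s f : inB s f -> cintegrable f. Proof. by case. Qed.

Lemma inB_lin s (a : R[i]) f g : inB s f -> inB s g ->
  inB s (fun x => a * f x + g x).
Proof.
move=> [fi f0] [gi g0]; split=> [|t st]; first exact: cintegrable_lin.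
by rewrite fourier_lin// f0// g0// mulr0 addr0.
Qed.

Lemma inB0 s : inB s (fun=> 0 : R[i]).
Proof.
split=> [|t _]; first exact: cintegrable0.
by rewrite -[RHS](@cint0 R); congr cint; apply/funext => x; rewrite mul0r.
Qed.

Lemma inBZ s (a : R[i]) f : inB s f -> inB s (fun x => a * f x).
Proof.
move=> fB; have := inB_lin a fB (inB0 s).
by congr inB; apply/funext => x; rewrite addr0.
Qed.

Lemma inBB s f g : inB s f -> inB s g -> inB s (fun x => f x - g x).
Proof.
move=> fB gB; have := inB_lin (-1) gB fB.
by congr inB; apply/funext => x; rewrite mulN1r addrC.
Qed.

Lemma inD_cintegrable s f : inD s f -> cintegrable f.
Proof. by move=> [[]]. Qed.

End BernsteinSpace.

Section ComplexSmoothRepresentative.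
Variables (R : realType) (s : R).
Hypothesis s0 : 0 <= s.
Local Notation leb := (@lebesgue_measure R).
Local Notation F := (R -> R[i]).
Implicit Types (f g : F).

Definition smooth_rep f : F := fun x =>
  Complex (bl_rep s (fun x => cRe (f x)) x) (bl_rep s (fun x => cIm (f x)) x).

Lemma cpart_smooth_rep b f x :
  cpart b (smooth_rep f x) = bl_rep s (fun x => cpart b (f x)) x.
Proof. by case: b. Qed.

Lemma smooth_rep_cpart_ae b f : inB s f ->
  {ae leb, forall x, cpart b (f x) = cpart b (smooth_rep f x)}.
Proof.
move=> /(inBP _ s0)/(_ b) fb; apply: filterS (bl_rep_ae s0 fb.1 fb) => x ->.
by rewrite cpart_smooth_rep.
Qed.

Lemma smooth_rep_ae f : inB s f -> L1eq f (smooth_rep f).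
Proof.
move=> fB; apply: filterS2 (smooth_rep_cpart_ae true fB)
  (smooth_rep_cpart_ae false fB).
by move=> x; exact: complex_ext.
Qed.

Lemma inB_smooth_rep f : inB s f -> inB s (smooth_rep f).
Proof.
move=> fB; have /(inBP _ s0) fb := fB; apply/(inBP _ s0) => b.
apply: ae_eq_bandlimited (fb b) _ (smooth_rep_cpart_ae b fB).
under eq_fun do rewrite cpart_smooth_rep.
exact: continuous_measurable_fun (continuous_bl_rep s0 (fb b).1).
Qed.

Lemma inD_smooth_rep f : inD s f -> inD s (smooth_rep f).
Proof.
move=> [fB f1]; have rB := inB_smooth_rep fB; split=> //.
rewrite -(L1norm_ae_eq (inB_cintegrable fB) (inB_cintegrable rB))//.
exact: smooth_rep_ae.
Qed.

Lemma inB_neq0_ae f : inB s f -> L1norm f != 0 -> {ae leb, forall x, f x != 0}.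
Proof.
move=> fB; have /(inBP _ s0) fb := fB; apply: contraPP => f_zeros.
have rep0 b x : cpart b (smooth_rep f x) = 0.
  rewrite cpart_smooth_rep; apply: contrapT => rep_neq0; apply: f_zeros.
  apply: filterS2 (smooth_rep_cpart_ae b fB)
    (bl_rep_neq0_ae s0 (fb b).1 (ex_intro _ x rep_neq0)) => y fy.
  rewrite -cpart_smooth_rep -fy => fy0; apply/eqP => fy_eq0; apply: fy0.
  by rewrite fy_eq0 cpart0.
apply/negP; rewrite negbK (L1norm_ae_eq (inB_cintegrable fB) (cintegrable0 R)).
  by rewrite L1norm0.
apply: filterS (smooth_rep_ae fB) => x ->; apply: eq_cpart => b.
by rewrite rep0 cpart0.
Qed.

Lemma ler_norm_cpart_smooth_rep b f x : inD s f ->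
  `|cpart b (smooth_rep f x)| <= pi^-1 * s.
Proof.
move=> fD; have fi := inD_cintegrable fD; have /cintegrableP fbi := fi.
rewrite cpart_smooth_rep; apply: le_trans (ler_norm_bl_rep s0 (fbi b) x) _.
rewrite ler_piMr ?mulr_ge0 ?invr_ge0 ?pi_ge0//.
exact: le_trans (Rintegral_norm_cpart_le b fi) fD.2.
Qed.

Lemma cpart_smooth_rep_lipschitz b f x y : inD s f ->
  `|cpart b (smooth_rep f x) - cpart b (smooth_rep f y)| <=
  pi^-1 * s * s * `|x - y|.
Proof.
move=> fD; have fi := inD_cintegrable fD; have /cintegrableP fbi := fi.
rewrite !cpart_smooth_rep; apply: le_trans (bl_rep_lipschitz s0 (fbi b) x y) _.
rewrite !ler_wpM2r// ler_piMr ?mulr_ge0 ?invr_ge0 ?pi_ge0//.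
exact: le_trans (Rintegral_norm_cpart_le b fi) fD.2.
Qed.

Lemma cnorm_smooth_rep_le f x : inD s f ->
  cnorm (smooth_rep f x) <= pi^-1 * s + pi^-1 * s.
Proof.
move=> fD; apply: le_trans (ler_cnorm _) (lerD _ _).
  exact: ler_norm_cpart_smooth_rep true f x fD.
exact: ler_norm_cpart_smooth_rep false f x fD.
Qed.

End ComplexSmoothRepresentative.

Section UnitBallCompactness.
Variables (R : realType) (s : R).
Hypothesis s0 : 0 <= s.
Local Notation leb := (@lebesgue_measure R).
Local Notation F := (R -> R[i]).
Implicit Types (f g u : F) (Phi : F -> R[i]).

Lemma inD_complex_cvg (G : nat -> F) g (K : R) : (forall n, inD s (G n)) ->
  (forall n x, cnorm (G n x) <= K) -> (forall x, complex_cvg (G ^~ x) (g x)) ->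
  inD s g.
Proof.
move=> GD GK Gg; have Gi n := inD_cintegrable (GD n).
have [ng g1] := Rintegral_fatou (mu := leb) (fun n x => cnorm_ge0 (G n x))
  (fun n => cintegrable_cnorm (Gi n)) (fun n => (GD n).2)
  (fun x => complex_cvg_cnorm (Gg x)).
have part_cvg b x := (complex_cvgP _ _).1 (Gg x) b.
have gi : cintegrable g.
  apply: le_cintegrable ng => // b.
  apply: (measurable_fun_cvg (h := fun n x => cpart b (G n x))) => [n|x _].
    exact: Rintegrable_measurable ((cintegrableP _).1 (Gi n) b).
  exact: part_cvg.
split=> //; apply/(inBP _ s0) => b.
apply: (@bandlimited_cvg _ s K 1 (fun n x => cpart b (G n x))) => [n|n x|n||x].
- exact: (inBP _ s0).1 (GD n).1 b.
- exact: le_trans (ler_norm_cpart b _) (GK n x).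
- exact: le_trans (Rintegral_norm_cpart_le b (Gi n)) (GD n).2.
- exact: (cintegrableP g).1 gi b.
- exact: part_cvg.
Qed.

Lemma inD_subsequence (fn : nat -> F) : (forall n, inD s (fn n)) ->
  exists2 g, inD s g & exists2 phi, (forall k, (k <= phi k)%N) &
    forall x, complex_cvg (fun k => smooth_rep s (fn (phi k)) x) (g x).
Proof.
move=> fD; have [g [phi phi_ge part_cvg]] := lipschitz_subsequence
  (fun n b x => ler_norm_cpart_smooth_rep s0 b x (fD n))
  (fun n b x y => cpart_smooth_rep_lipschitz s0 b x y (fD n)).
have cv x : complex_cvg (fun k => smooth_rep s (fn (phi k)) x)
    (Complex (g true x) (g false x)).
  by apply/complex_cvgP => b; have := part_cvg b x; case: b.
exists (fun x => Complex (g true x) (g false x)); last by exists phi.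
apply: inD_complex_cvg (fun k => inD_smooth_rep s0 (fD (phi k))) _ cv => k x.
exact: cnorm_smooth_rep_le.
Qed.

Lemma C0_vanishes_at_infinity u :
  C0 u -> vanishes_at_infinity (fun x => cnorm (u x)).
Proof.
by move=> [_ [_ u0]] e /u0[X uX]; exists X => x /uX;
  rewrite ger0_norm ?cnorm_ge0.
Qed.

Lemma C0_continuous_cnorm u : C0 u -> continuous (fun x => cnorm (u x)).
Proof.
move=> [ur [ui _]] x; apply: continuous_comp; last exact: sqrt_continuous.
by apply: cvgD; apply: (@cvg_comp _ _ _ _ (fun y : R => y ^+ 2));
  [exact: ur|exact: exprn_continuous|exact: ui|exact: exprn_continuous].
Qed.

Lemma cnorm_pairing_le f u : C0 u -> cintegrable f ->
  cnorm (pairing f u) <= \int[leb]_x (cnorm (f x) * cnorm (u x)).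
Proof.
move=> uC0 fi; have [ur [ui _]] := uC0.
have [M uM] := vanishes_at_infinity_bounded (C0_continuous_cnorm uC0)
  (C0_vanishes_at_infinity uC0).
have fui : cintegrable (fun x => f x * u x).
  apply: (cintegrable_mul_bounded (C := M) fi) => [[]|x].
  - exact: continuous_measurable_fun ur.
  - exact: continuous_measurable_fun ui.
  - exact: le_trans (ler_norm _) (uM x).
have <- : L1norm (fun x => f x * u x) = \int[leb]_x (cnorm (f x) * cnorm (u x)).
  by apply: eq_Rintegral => x _; rewrite cnormM.
exact: cnorm_cint_le.
Qed.

Lemma pairing_cvg0 (d : nat -> F) u (A B : R) : C0 u ->
  (forall n, cintegrable (d n)) -> (forall n x, cnorm (d n x) <= A) ->
  (forall n, L1norm (d n) <= B) ->
  (forall x, cnorm (d n x) @[n --> \oo] --> (0 : R)) ->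
  cnorm (pairing (d n) u) @[n --> \oo] --> (0 : R).
Proof.
move=> uC0 di dA dB d0.
have cu := C0_continuous_cnorm uC0; have u0 := C0_vanishes_at_infinity uC0.
have [M uM] := vanishes_at_infinity_bounded cu u0.
have norm_cnorm (z : R[i]) : `|cnorm z| = cnorm z.
  by rewrite ger0_norm ?cnorm_ge0.
have dA' n x : `|cnorm (d n x)| <= A by rewrite norm_cnorm.
have dB' n : \int[leb]_x `|cnorm (d n x)| <= B.
  by under eq_Rintegral do rewrite norm_cnorm; exact: dB.
apply: squeeze_cvgr (cvg_cst 0) (cvg_Rintegral_mul_vanishing
  (fun n => cintegrable_cnorm (di n)) dA' dB' d0
  (continuous_measurable_fun cu) uM u0).
by apply: nearW => n; rewrite cnorm_ge0 cnorm_pairing_le.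
Qed.

Lemma weakstar_continuous_cvg Phi (G : nat -> F) g (K : R) :
  weakstar_continuous s Phi -> (forall n, inD s (G n)) -> inD s g ->
  (forall n x, cnorm (G n x) <= K) -> (forall x, complex_cvg (G ^~ x) (g x)) ->
  complex_cvg (Phi \o G) (Phi g).
Proof.
move=> wPhi GD gD GK Gg; apply/cvgrPdist_lt => e e0.
have [m [us [d [d0 [usC0 near_g]]]]] := wPhi g gD.1 e e0.
have gi := inD_cintegrable gD; have Gi n := inD_cintegrable (GD n).
have gK x : cnorm (g x) <= K.
  by apply: (ler_cvg_to (complex_cvg_cnorm (Gg x)) (cvg_cst K)); exact: nearW.
have dist_lt (z : R[i]) (r : R) : (`|0 - cnorm z| < r) = (cnorm z < r).
  by rewrite sub0r normrN ger0_norm ?cnorm_ge0.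
have near_us : \forall n \near \oo,
    forall i, cnorm (pairing (fun x => G n x - g x) (us i)) < d.
  apply: filter_forall => i.
  have /cvgrPdist_lt/(_ d d0) := pairing_cvg0 (usC0 i)
    (fun n => cintegrableB (Gi n) gi)
    (fun n x => le_trans (cnormB _ _) (lerD (GK n x) (gK x)))
    (fun n => le_trans (L1normB_le (Gi n) gi) (lerD (GD n).2 gD.2)) Gg.
  by apply: filterS => n; rewrite dist_lt.
by apply: filterS near_us => n near_n; rewrite dist_lt;
  exact: near_g (GD n).1 near_n.
Qed.

End UnitBallCompactness.

Section Functionals.
Variables (R : realType) (s : R).
Local Notation F := (R -> R[i]).
Implicit Types (f g : F) (Phi Psi : F -> R[i]).
Local Open Scope complex_scope.

Definition contractive Phi : Prop :=
  forall g, inB s g -> cnorm (Phi g) <= L1norm g.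

Lemma linear_on_B0 Phi : linear_on_B s Phi -> Phi (fun=> 0) = 0.
Proof.
move=> lin; have := lin 1 _ _ (inB0 s) (inB0 s).
have -> : (fun x : R => 1 * (0 : R[i]) + 0) = (fun=> 0).
  by apply/funext => x; rewrite mulr0 addr0.
by rewrite mul1r => /eqP; rewrite addrC -subr_eq subrr eq_sym => /eqP.
Qed.

Lemma linear_on_BZ Phi (a : R[i]) f : linear_on_B s Phi -> inB s f ->
  Phi (fun x => a * f x) = a * Phi f.
Proof.
move=> lin fB; have := lin a _ _ fB (inB0 s);
  rewrite linear_on_B0// addr0 => <-.
by congr Phi; apply/funext => x; rewrite addr0.
Qed.

Lemma linear_on_BB Phi f g : linear_on_B s Phi -> inB s f -> inB s g ->
  Phi (fun x => f x - g x) = Phi f - Phi g.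
Proof.
move=> lin fB gB; have := lin (-1) _ _ gB fB; rewrite mulN1r addrC => <-.
by congr Phi; apply/funext => x; rewrite mulN1r addrC.
Qed.

Lemma cont_lin_functional_bounded Phi : cont_lin_functional s Phi ->
  has_ubound [set r | exists2 g, inD s g & r = cnorm (Phi g)].
Proof.
move=> [lin cont]; have [d [d0 dP]] := cont _ (inB0 s) 1 ltr01.
have d2 : 0 <= d / 2 by rewrite divr_ge0// ltW.
exists (2 / d) => _ [h [hB h1] ->].
have := dP _ (inBZ (d / 2)%:C hB).
have -> : (fun x => (d / 2)%:C * h x - 0) = fun x => (d / 2)%:C * h x.
  by apply/funext => x; rewrite subr0.
rewrite (L1normZ _ (inB_cintegrable hB)) (linear_on_BZ _ lin hB).
rewrite linear_on_B0// subr0 cnormM cnorm_real_ge0// => small.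
rewrite -invf_div -[leRHS]mul1r ler_pdivlMr ?divr_gt0// mulrC ltW//;
  apply: small.
by apply: (@le_lt_trans _ _ (d / 2 * 1)); rewrite ?ler_wpM2l//; lra.
Qed.

Lemma cnorm_le_opnorm Phi g : cont_lin_functional s Phi -> inB s g ->
  cnorm (Phi g) <= opnorm s Phi * L1norm g.
Proof.
move=> cPhi gB; have [lin _] := cPhi; have gi := inB_cintegrable gB.
have bound e : 0 < e -> cnorm (Phi g) <= opnorm s Phi * (L1norm g + e).
  move=> e0; have c0 : 0 < L1norm g + e by rewrite ltr_wpDl ?L1norm_ge0.
  have ci : cnorm (L1norm g + e)^-1%:C = (L1norm g + e)^-1.
    by rewrite cnorm_real_ge0// invr_ge0 ltW.
  rewrite -ler_pdivrMr// mulrC -{1}ci -cnormM -linear_on_BZ//.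
  apply: ub_le_sup; first exact: cont_lin_functional_bounded.
  exists (fun x => (L1norm g + e)^-1%:C * g x) => //; split; first exact: inBZ.
  by rewrite L1normZ// ci ler_pdivrMl// mulr1 lerDl ltW.
have cv : opnorm s Phi * (L1norm g + n.+1%:R^-1) @[n --> \oo] -->
    opnorm s Phi * (L1norm g + 0).
  apply: cvgM; first exact: cvg_cst.
  by apply: cvgD; [exact: cvg_cst|exact: cvg_harmonic].
rewrite -[L1norm g]addr0; apply: (ler_cvg_to (cvg_cst _) cv).
by apply: nearW => n; apply: bound; rewrite invr_gt0.
Qed.

Lemma exposing_contractive f Phi : exposing s f Phi -> contractive Phi.
Proof.
move=> [cPhi [_ [Phi1 _]]] g gB.
by apply: le_trans (cnorm_le_opnorm cPhi gB) _; rewrite Phi1 mul1r.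
Qed.

Lemma contractive_ae_eq Phi f g : linear_on_B s Phi -> contractive Phi ->
  inB s f -> inB s g -> L1eq f g -> Phi f = Phi g.
Proof.
move=> lin con fB gB fg; apply/eqP; rewrite -subr_eq0; apply/eqP/cnorm_eq0/eqP.
have fgB := inBB fB gB; rewrite eq_le cnorm_ge0 andbT -linear_on_BB//.
apply: le_trans (con _ fgB) _.
rewrite (L1norm_ae_eq (inB_cintegrable fgB) (cintegrable0 R)) ?L1norm0//.
by apply: filterS fg => x ->; rewrite subrr.
Qed.

Lemma contractive_L1norm_eq1 Phi g : contractive Phi -> inD s g -> Phi g = 1 ->
  L1norm g = 1.
Proof.
move=> con [gB g1] Phig; apply/eqP; rewrite eq_le g1 /=.
by rewrite -(cnorm1 R) -Phig con.
Qed.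

End Functionals.

Section NormSmoothness.
Variable R : realType.
Local Notation leb := (@lebesgue_measure R).
Local Notation F := (R -> R[i]).
Implicit Types (z w : R[i]) (f g : F) (Phi Psi : F -> R[i]).
Local Open Scope complex_scope.

Definition second_difference z w : R :=
  cnorm (z + w) + cnorm (z - w) - cnorm z *+ 2.

Lemma second_difference_ge0 z w : 0 <= second_difference z w.
Proof.
rewrite subr_ge0; have := cnormD (z + w) (z - w).
by rewrite addrACA subrr addr0 -mulr2n cnormMn.
Qed.

Lemma second_difference_le z w : second_difference z w <= cnorm w *+ 2.
Proof.
by have := cnormD z w; have := cnormB z w; rewrite /second_difference; lra.
Qed.

Lemma second_difference_le_sqr z w : z != 0 ->
  second_difference z w <= cnorm w ^+ 2 / cnorm z.
Proof.
move=> z0; have nz : 0 < cnorm z.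
  rewrite lt_neqAle cnorm_ge0 andbT eq_sym;
    apply: contraNneq z0 => /cnorm_eq0 ->.
  by [].
have nw := cnorm_ge0 w; have np := cnorm_ge0 (z + w);
  have nm := cnorm_ge0 (z - w).
rewrite lerBlDr -ler_sqr ?nnegrE; first last.
- by rewrite addr_ge0 ?divr_ge0 ?sqr_ge0 ?mulrn_wge0 ?(ltW nz).
- by rewrite addr_ge0.
apply: (@le_trans _ _ ((cnorm z ^+ 2 + cnorm w ^+ 2) *+ 4)).
  have : cnorm (z + w) ^+ 2 + cnorm (z - w) ^+ 2 =
    (cnorm z ^+ 2 + cnorm w ^+ 2) *+ 2.
    by rewrite !sqr_cnorm !cReD !cImD cReN cImN; ring.
  have := sqr_ge0 (cnorm (z + w) - cnorm (z - w)).
  by rewrite sqrrB sqrrD; lra.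
rewrite sqrrD mulrnAr mulfVK ?gt_eqF//.
by have := sqr_ge0 (cnorm w ^+ 2 / cnorm z); lra.
Qed.

Lemma Rintegrable_second_difference f g : cintegrable f -> cintegrable g ->
  Rintegrable leb (fun x => second_difference (f x) (g x)).
Proof.
move=> fi gi; have nf := cintegrable_cnorm fi.
have nD := cintegrable_cnorm (cintegrableD fi gi).
have nB := cintegrable_cnorm (cintegrableB fi gi).
have := RintegrableB (RintegrableD nD nB) (RintegrableD nf nf).
by congr Rintegrable; apply/funext => x; rewrite /second_difference mulr2n.
Qed.

Lemma L1norm_second_difference f g : cintegrable f -> cintegrable g ->
  L1norm (fun x => f x + g x) + L1norm (fun x => f x - g x) - L1norm f *+ 2 =
  \int[leb]_x second_difference (f x) (g x).
Proof.
move=> fi gi; have nf := cintegrable_cnorm fi.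
have nD := cintegrable_cnorm (cintegrableD fi gi).
have nB := cintegrable_cnorm (cintegrableB fi gi).
rewrite mulr2n -(RintegralD measurableT nD nB) -(RintegralD measurableT nf nf).
rewrite -(RintegralB measurableT (RintegrableD nD nB) (RintegrableD nf nf)).
by apply: eq_Rintegral => x _; rewrite /second_difference mulr2n.
Qed.

(* The second difference of |.| at f x is O(1 / n^2) wherever f x <> 0, and it
   is dominated by 2 |g x| / n. *)
Lemma cvg_L1norm_second_difference f g : cintegrable f -> cintegrable g ->
  {ae leb, forall x, f x != 0} ->
  n.+1%:R * (L1norm (fun x => f x + n.+1%:R^-1%:C * g x) +
    L1norm (fun x => f x - n.+1%:R^-1%:C * g x) - L1norm f *+ 2)
  @[n --> \oo] --> (0 : R).
Proof.
move=> fi gi fn0; pose w n x : R[i] := n.+1%:R^-1%:C * g x.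
have wi n : cintegrable (w n).
  have := cintegrable_lin n.+1%:R^-1%:C gi (cintegrable0 R).
  by congr cintegrable; apply/funext => x; rewrite addr0.
have cw n x : cnorm (w n x) = n.+1%:R^-1 * cnorm (g x).
  by rewrite cnormM cnorm_real_ge0.
pose k n x := n.+1%:R * second_difference (f x) (w n x).
have nw n x : n.+1%:R * cnorm (w n x) = cnorm (g x).
  by rewrite cw mulrA mulfV// mul1r.
have k0 n x : 0 <= k n x by rewrite mulr_ge0// second_difference_ge0.
have ik n : Rintegrable leb (k n).
  by apply: RintegrableZl; exact: Rintegrable_second_difference.
have -> : (fun n => n.+1%:R * (L1norm (fun x => f x + w n x) +
    L1norm (fun x => f x - w n x) - L1norm f *+ 2)) =
    fun n => \int[leb]_x k n x.
  apply/funext => n; rewrite L1norm_second_difference// -RintegralZl//.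
  exact: Rintegrable_second_difference.
rewrite -[X in _ --> X](@Rintegral_eq0 _ _ _ leb setT (fun=> 0))//.
have dominated_cvg := @Rintegral_dominated_cvg _ _ _ leb k (fun=> 0)
  (fun x => 2 * cnorm (g x)).
apply: dominated_cvg => //.
- by move=> n; exact: Rintegrable_measurable (ik n).
- apply: filterS fn0 => x fx0.
  apply: (@cvg_harmonic_dist _ _ _ (cnorm (g x) ^+ 2 / cnorm (f x))) => n.
  rewrite subr0 ger0_norm//.
  apply: le_trans (ler_wpM2l _ (second_difference_le_sqr (w n x) fx0)) _ => //.
  have nfx0 : cnorm (f x) != 0 by apply: contraNneq fx0 => /cnorm_eq0 ->.
  rewrite cw le_eqVlt; apply/orP; left; apply/eqP.
  by field; rewrite nfx0 nat1r pnatr_eq0.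
- exact/RintegrableZl/cintegrable_cnorm.
- move=> n x; rewrite ger0_norm//.
  apply: le_trans (ler_wpM2l _ (second_difference_le (f x) (w n x))) _ => //.
  by rewrite mulrnAr nw mulr_natl.
Qed.

(* Testing Phi on f + t g and Psi on f - t g bounds t Re (Phi g - Psi g) by a
   second difference of the norm at f. *)
Lemma contractive_cRe_le (s : R) Phi Psi f g :
  linear_on_B s Phi -> linear_on_B s Psi ->
  contractive s Phi -> contractive s Psi -> inD s f -> Phi f = 1 -> Psi f = 1 ->
  {ae leb, forall x, f x != 0} -> inB s g -> cRe (Phi g) <= cRe (Psi g).
Proof.
move=> lPhi lPsi cPhi cPsi fD Phif Psif fn0 gB; have fB := fD.1.
have L1f := contractive_L1norm_eq1 cPhi fD Phif.
have cRe_norm (z : R[i]) r : cnorm z <= r -> cRe z <= r.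
  by apply: le_trans; exact: le_trans (ler_norm _) (ler_norm_cpart true _).
rewrite -subr_le0; apply: (ler_cvg_to (cvg_cst _) (cvg_L1norm_second_difference
  (inB_cintegrable fB) (inB_cintegrable gB) fn0)).
apply: nearW => n; set t := n.+1%:R^-1; rewrite L1f -ler_pdivrMl// -/t.
have fpE : (fun x => f x + t%:C * g x) = fun x => t%:C * g x + f x.
  by apply/funext => x; rewrite addrC.
have fmE : (fun x => f x - t%:C * g x) = fun x => (- t%:C) * g x + f x.
  by apply/funext => x; rewrite addrC mulNr.
have up := cRe_norm _ _ (cPhi _ (inB_lin t%:C gB fB)).
have um := cRe_norm _ _ (cPsi _ (inB_lin (- t%:C) gB fB)).
rewrite lPhi// Phif -fpE in up; rewrite lPsi// Psif -fmE in um.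
move: up um; rewrite !cReD !cReM cReN cImN !mul0r oppr0 mul0r !subr0 mulNr.
by rewrite mulr2n mulrBr -[cRe t%:C]/t -[cRe 1]/(1 : R); lra.
Qed.

Lemma contractive_unique (s : R) Phi Psi f g :
  linear_on_B s Phi -> linear_on_B s Psi ->
  contractive s Phi -> contractive s Psi -> inD s f -> Phi f = 1 -> Psi f = 1 ->
  {ae leb, forall x, f x != 0} -> inB s g -> Phi g = Psi g.
Proof.
move=> lPhi lPsi cPhi cPsi fD Phif Psif fn0 gB.
have re g' : inB s g' -> cRe (Phi g') = cRe (Psi g').
  by move=> g'B; apply/eqP; rewrite eq_le !(@contractive_cRe_le s _ _ f).
apply: complex_ext; first exact: re.
have := re _ (inBZ 'i%C gB).
rewrite (linear_on_BZ _ lPhi gB) (linear_on_BZ _ lPsi gB) !cReM.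
by rewrite !mul0r !mul1r !sub0r => /oppr_inj.
Qed.

End NormSmoothness.

Section WeakStarExposed.
Variables (R : realType) (s : R).
Hypothesis s0 : 0 <= s.
Local Notation leb := (@lebesgue_measure R).
Local Notation F := (R -> R[i]).
Implicit Types (f g : F) (Phi : F -> R[i]).

Lemma wstar_exposing_subsequence f Phi (fn : nat -> F) :
  inD s f -> exposing s f Phi -> weakstar_continuous s Phi ->
  (forall n, inD s (fn n)) -> complex_cvg (Phi \o fn) 1 ->
  exists2 phi, (forall k, (k <= phi k)%N) &
    L1norm (fun x => fn (phi k) x - f x) @[k --> \oo] --> (0 : R).
Proof.
move=> fD ex wPhi fnD Phi1; have con := exposing_contractive ex.
have [[lin _] [Phif [_ exp]]] := ex.
have [g gD [phi phi_ge cv]] := inD_subsequence s0 fnD.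
pose G k := smooth_rep s (fn (phi k)).
have GD k : inD s (G k) by exact: inD_smooth_rep.
have fnG k : L1eq (fn (phi k)) (G k) by exact: smooth_rep_ae (fnD _).1.
have Phig : Phi g = 1.
  apply: complex_cvg_unique (weakstar_continuous_cvg wPhi GD gD
    (fun k x => cnorm_smooth_rep_le s0 x (fnD (phi k))) cv) _.
  have PhiG k : Phi (G k) = Phi (fn (phi k)).
    exact/esym/(contractive_ae_eq lin con (fnD _).1 (GD k).1 (fnG k)).
  rewrite /complex_cvg /=; under eq_fun do rewrite PhiG.
  exact: (cvg_comp _ _ (cvgn_ge_id phi_ge) Phi1).
have gf : L1eq g f.
  by apply: contrapT => /(exp g gD); rewrite Phig /cRe /= ltxx.
have Gi k := inD_cintegrable (GD k); have gi := inD_cintegrable gD.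
have G_le k : L1norm (G k) <= L1norm g.
  by rewrite (contractive_L1norm_eq1 con gD Phig); exact: (GD k).2.
exists phi => //; have := L1norm_scheffe Gi gi G_le cv.
have -> // : (fun k => L1norm (fun x => fn (phi k) x - f x)) =
  fun k => L1norm (fun x => G k x - g x).
apply/funext => k; apply: L1norm_ae_eq.
- exact: cintegrableB (inD_cintegrable (fnD _)) (inD_cintegrable fD).
- exact: cintegrableB.
- by apply: filterS2 (fnG k) gf => x -> ->.
Qed.

Lemma wstar_exposing_strong f Phi (fn : nat -> F) :
  inD s f -> exposing s f Phi -> weakstar_continuous s Phi ->
  (forall n, inD s (fn n)) -> complex_cvg (Phi \o fn) 1 ->
  L1norm (fun x => fn n x - f x) @[n --> \oo] --> (0 : R).
Proof.
move=> fD ex wPhi fnD Phi1; apply: cvg_subsubsequence => psi psi_ge.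
apply: (wstar_exposing_subsequence fD ex wPhi (fun k => fnD (psi k))).
exact: (cvg_comp _ _ (cvgn_ge_id psi_ge) Phi1).
Qed.

Lemma exposing_unique f Phi Psi g : exposing s f Phi -> exposing s f Psi ->
  inD s f -> inB s g -> Phi g = Psi g.
Proof.
move=> exPhi exPsi fD gB.
have [[lPhi _] [Phif _]] := exPhi; have [[lPsi _] [Psif _]] := exPsi.
have cPhi := exposing_contractive exPhi;
  have cPsi := exposing_contractive exPsi.
apply: (contractive_unique lPhi lPsi cPhi cPsi fD Phif Psif) => //.
apply: (inB_neq0_ae s0 fD.1).
by rewrite (contractive_L1norm_eq1 cPhi fD Phif) oner_neq0.
Qed.

End WeakStarExposed.

Theorem theorem4p4 (R : realType) (sigma : R) (hsigma : 0 < sigma)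
  (f : R -> R[i]) :
  wstar_exposed sigma f <-> wstar_strongly_exposed sigma f.
Proof.
split=> [wf|[]//]; split=> //; have [fD [Phi [exPhi wPhi]]] := wf.
split=> [|Psi exPsi fn fnD Psi1]; first by split=> //; exists Phi.
have s0 := ltW hsigma; apply: (wstar_exposing_strong s0 fD exPhi wPhi fnD).
rewrite /complex_cvg /=.
under eq_fun do rewrite (exposing_unique s0 exPhi exPsi fD (fnD _).1).
exact: Psi1.
Qed.
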